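(* Let $n\geq 1$ and let $V:\mathbb{R}^n\to\mathbb{R}$ be bounded and continuous with $V(x)>0$ for all $x\in\mathbb{R}^n$. Then there exists a constant $C>0$, independent of $t$ and of the initial data, such that the following holds. Let $u_0\in L^2(\mathbb{R}^n)$ satisfy \[ K_{0,h}^2:=\int_{\mathbb{R}^n}\frac{|u_0(x)|^2}{V(x)}\,dx<+\infty, \] and let $u\in C([0,\infty);L^2(\mathbb{R}^n))\cap C^1((0,\infty);L^2(\mathbb{R}^n))\cap C((0,\infty);H^2(\mathbb{R}^n))$ be the unique solution of \[ u_t-\Delta u+V(x)u=0\quad (t>0,\ x\in\mathbb{R}^n),\qquad u(0,x)=u_0(x)\quad (x\in\mathbb{R}^n). \] Then \[ (1+t)\|u(t,\cdot)\|^2\leq C\left(\|u_0\|^2+K_{0,h}^2\right)\qquad\text{for all } t\geq 0. \]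
   Context: All functions are real-valued. $\|\cdot\|$ denotes the norm of $L^2(\mathbb{R}^n)$. The operator $H:=-\Delta+V$ is non-negative and self-adjoint in $L^2(\mathbb{R}^n)$ with domain $H^2(\mathbb{R}^n)$, and a unique solution in the stated class exists for every $u_0\in L^2(\mathbb{R}^n)$. *)

(* Defs.v *)
From HB Require Import structures.
From mathcomp Require Import all_boot all_order all_algebra.
From mathcomp Require Import all_classical all_reals all_analysis.
Import Order.TTheory GRing.Theory Num.Theory.
Import numFieldNormedType.Exports.

Set Implicit Arguments.
Unset Strict Implicit.
Unset Printing Implicit Defensive.

Local Open Scope classical_set_scope.
Local Open Scope ring_scope.

(* R^n is 'rV[R]_n: the library gives it its topology and its derivatives, but
   neither a sigma-algebra nor Lebesgue measure. It gets the product
   sigma-algebra, which is the Borel one; this mirrors the library's instance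
   on n.-tuple T. *)
Definition measure_rV_display : measure_display -> measure_display.
Proof. exact. Qed.

Section measurable_rV.
Context {R : realType} (n : nat).

Let coors : 'I_n -> 'rV[R]_n -> R := fun i x => x ord0 i.

Let rV_set0 : g_sigma_preimage coors set0.
Proof. exact: sigma_algebra0. Qed.

Let rV_setC A : g_sigma_preimage coors A -> g_sigma_preimage coors (~` A).
Proof. exact: sigma_algebraC. Qed.

Let rV_bigcup (F : _^nat) : (forall i, g_sigma_preimage coors (F i)) ->
  g_sigma_preimage coors (\bigcup_i (F i)).
Proof. exact: sigma_algebra_bigcup. Qed.

HB.instance Definition _ := @isMeasurable.Build
  (measure_rV_display (R.-ocitv.-measurable).-sigma)
  'rV[R]_n (g_sigma_preimage coors) rV_set0 rV_setC rV_bigcup.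

End measurable_rV.

Section lebesgue_rV.
Context {R : realType}.

Lemma measurable_coord n (i : 'I_n) :
  measurable_fun [set: 'rV[R]_n] (fun x => x ord0 i).
Proof.
move=> _ Y mY; rewrite setTI; apply: sub_sigma_algebra => /=.
rewrite -bigcup_seq/=; exists i => /=; first by rewrite mem_index_enum.
by exists Y => //; rewrite setTI.
Qed.

Lemma measurable_fun_rVP d (T : measurableType d) n (f : T -> 'rV[R]_n) :
  (forall i, measurable_fun [set: T] (fun x => f x ord0 i)) ->
  measurable_fun [set: T] f.
Proof.
move=> mf.
have H : g_sigma_preimage (fun i => (fun x : 'rV[R]_n => x ord0 i) \o f)
    `<=` measurable.
  apply: smallest_sub; first exact: sigma_algebra_measurable.
  rewrite -bigcup_seq; apply: bigcup_sub => i _.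
  by move=> A [B mB <-]; exact: mf.
rewrite g_sigma_preimage_comp in H => _ A mA.
by apply: H; exists A.
Qed.

Definition consrV n (p : 'rV[R]_n * R) : 'rV[R]_n.+1 :=
  \row_i if unlift ord0 i is Some j then p.1 ord0 j else p.2.

Lemma consrV0 n (p : 'rV[R]_n * R) : consrV p ord0 ord0 = p.2.
Proof. by rewrite mxE unlift_none. Qed.

Lemma consrVS n (p : 'rV[R]_n * R) (i : 'I_n) :
  consrV p ord0 (lift ord0 i) = p.1 ord0 i.
Proof. by rewrite mxE liftK. Qed.

Lemma measurable_consrV n : measurable_fun [set: 'rV[R]_n * R] (@consrV n).
Proof.
apply: measurable_fun_rVP => i; have [j ->|->] := unliftP ord0 i.
- under [X in measurable_fun _ X]funext do rewrite consrVS.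
  exact: (measurableT_comp (measurable_coord j) measurable_fst).
- under [X in measurable_fun _ X]funext do rewrite consrV0.
  exact: measurable_snd.
Qed.

(* Lebesgue measure on R^n: the image of the product of the Lebesgue measures on
   R^(n-1) and R under consrV. The long name is the library's instance that
   makes pushforward by a measurable function a measure. *)
Fixpoint lebesgue_rV n : {measure set 'rV[R]_n -> \bar R} :=
  match n with
  | 0 => dirac (0 : 'rV[R]_0)
  | m.+1 => measure_function_pushforward__canonical__measure_function_Measure
      (lebesgue_rV m \x @lebesgue_measure R)%E (@measurable_consrV m)
  end.

Lemma lebesgue_rV_box n (A : 'I_n -> set R) : (forall i, measurable (A i)) ->
  lebesgue_rV n [set x | forall i, A i (x ord0 i)] =
  (\prod_(i < n) lebesgue_measure (A i))%E.
Proof.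
elim: n A => [|n IH] A mA.
  by rewrite big_ord0 /= diracE mem_set => // [[]].
rewrite big_ord_recl muleC -IH; last by move=> i; exact: mA.
have mB : measurable [set x : 'rV[R]_n | forall i, A (lift ord0 i) (x ord0 i)].
  rewrite (_ : [set _ | _] =
      \bigcap_(i in [set: 'I_n]) [set x : 'rV[R]_n | A (lift ord0 i) (x ord0 i)]).
    apply: fin_bigcap_measurable => // i _.
    by rewrite -[X in measurable X]setTI; apply: measurable_coord.
  by apply/seteqP; split => x /= h i; [move=> _|]; apply: h.
rewrite -product_measure1E//; last exact: mA.
rewrite [LHS]/= /pushforward; congr (product_measure1 _ _ _).
apply/seteqP; split => -[x r] /=.
  move=> h; split => [i|]; first by have := h (lift ord0 i); rewrite consrVS.
  by have := h ord0; rewrite consrV0.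
move=> [hx hr] i; have [j ->|->] := unliftP ord0 i; last by rewrite consrV0.
by rewrite consrVS.
Qed.

End lebesgue_rV.

Section L2_H2.
Context {R : realType} {n : nat}.
Implicit Types (f g w phi : 'rV[R]_n -> R) (s : seq 'I_n).
Local Notation mu := (lebesgue_rV n : {measure set 'rV[R]_n -> \bar R}).

(* Elements of L^2 and H^2 are represented by functions, equal when they agree
   almost everywhere. *)
Definition L2 : set ('rV[R]_n -> R) := [set f | f \in Lfun mu 2%:E].

Definition L2norm f : R := fine 'N[mu]_2%:E[EFin \o f].

Definition pderiv (i : 'I_n) f : 'rV[R]_n -> R := 'D_(delta_mx ord0 i) f.

Definition pderivs s f : 'rV[R]_n -> R := foldr pderiv f s.

Definition smooth f := forall s,
  continuous (pderivs s f) /\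
  forall i x, derivable (pderivs s f) x (delta_mx ord0 i).

Definition test_function phi :=
  smooth phi /\ compact (closure [set x | phi x != 0]).

Definition is_weak_pderivs s w g := forall phi, test_function phi ->
  \int[mu]_x (w x * pderivs s phi x) =
  (-1) ^+ size s * \int[mu]_x (g x * phi x).

Definition H2 : set ('rV[R]_n -> R) :=
  [set w | L2 w /\
    forall s, (size s <= 2)%N -> exists2 g, L2 g & is_weak_pderivs s w g].

(* A representative of the L^2 weak derivative, which is unique up to a.e.
   equality. *)
Definition weak_pderivs s w : 'rV[R]_n -> R :=
  xget (fun=> 0) [set g | L2 g /\ is_weak_pderivs s w g].

(* Mixed derivatives are counted once per ordering of the indices, which gives
   a norm equivalent to the one indexed by multi-indices. *)
Definition H2norm w : R :=
  Num.sqrt (\sum_(k < 3) \sum_(s : k.-tuple 'I_n) L2norm (weak_pderivs s w) ^+ 2).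

Definition weak_laplacian w : 'rV[R]_n -> R :=
  fun x => \sum_(i < n) weak_pderivs [:: i; i] w x.

(* u \in C(I; X), for X a space of functions with norm N. *)
Definition continuous_path (X : set ('rV[R]_n -> R)) (N : ('rV[R]_n -> R) -> R)
    (I : set R) (u : R -> 'rV[R]_n -> R) :=
  (forall t, I t -> X (u t)) /\
  forall t, I t -> N (u r \- u t) @[r --> within I (nbhs t)] --> (0 : R).

Definition L2_derivative (u : R -> 'rV[R]_n -> R) (t : R) g :=
  L2norm (fun x => h^-1 * (u (t + h) x - u t x) - g x) @[h --> 0^'] --> (0 : R).

(* u \in C^1(I; L^2) with derivative v, for I open. *)
Definition L2_C1_path (I : set R) (u v : R -> 'rV[R]_n -> R) :=
  [/\ continuous_path L2 L2norm I u, continuous_path L2 L2norm I v &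
      forall t, I t -> L2_derivative u t (v t)].

Definition heat_solution (V u0 : 'rV[R]_n -> R) (u : R -> 'rV[R]_n -> R) :=
  [/\ continuous_path L2 L2norm `[0, +oo[ u,
      continuous_path H2 H2norm `]0, +oo[ u,
      u 0 = u0 %[ae mu] &
      exists2 ut, L2_C1_path `]0, +oo[ u ut &
        forall t, 0 < t ->
          {ae mu, forall x, ut t x - weak_laplacian (u t) x + V x * u t x = 0}].

Definition weighted_norm2 (V u0 : 'rV[R]_n -> R) : \bar R :=
  (\int[mu]_x (`|u0 x| ^+ 2 / V x)%:E)%E.

End L2_H2.

(* Main.v *)
Require Import Defs.
From HB Require Import structures.
From mathcomp Require Import all_boot all_order all_algebra.
From mathcomp Require Import all_classical all_reals all_analysis.
From mathcomp Require Import measurable_realfun ring lra.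
Import Order.TTheory GRing.Theory Num.Theory.
Import numFieldNormedType.Exports.

Set Implicit Arguments.
Unset Strict Implicit.
Unset Printing Implicit Defensive.

Local Open Scope classical_set_scope.
Local Open Scope ring_scope.

(** Write [H = -Delta + V] and [E t = |u t|^2]. Symmetry of [H] makes
    [s |-> (u s, u (xi - s))] constant, so [E (xi / 2) = (u0, u xi)]; and
    [E' = - 2 (H u, u) <= - 2 \int V u^2]. For [T > 0] the mean value theorem
    gives [xi] in [(T, 2T)] with [- E' xi <= E T / T]. As [E] is nonincreasing,
    Cauchy-Schwarz with the weight [V] yields, for [K^2 = \int u0^2 / V],
    [E T <= E (xi / 2) = (u0, u xi) <= K (\int V (u xi)^2)^(1/2)
         <= K (E T / (2 T))^(1/2)], that is [2 T E T <= K^2].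

    Symmetry and sign of the weak Laplacian on [H^2] come from integration by
    parts for L^2 weak derivatives. A difference quotient of [v] is bounded in
    L^2 by the weak derivative of [v] and converges to it when tested against
    test functions, hence against all of L^2 by density; and the discrete
    integration by parts is translation invariance of Lebesgue measure. *)

(** * The inner product of L2 *)

(** As [V] may tend to 0 at infinity, the dissipation of [\int V u^2] alone gives no rate for [E].
    The weight [1 / V] on the data compensates for this, provided that one factor of the energy is
    the datum itself; pairing the solution with its own time reversal achieves this without a
    semigroup or a spectral resolution of [H]. The mean value theorem makes [\int V (u xi)^2] small
    only at some [xi] of an interval, not at a prescribed time. The window [(T, 2T)] is chosen so
    that [xi / 2 < T]: monotonicity then leads from the midpoint [xi / 2] to [T]. For data merely in
    L^2 the energy need not be differentiable at time 0, so each argument that starts there combines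
    continuity on a closed interval with derivatives in its interior. *)

Lemma ler_sqr_norm (R : realDomainType) (x y : R) :
  `|x| <= `|y| -> x ^+ 2 <= y ^+ 2.
Proof. rewrite -[x ^+ 2]real_normK ?num_real// -[y ^+ 2]real_normK ?num_real//.
by move=> xy; rewrite ler_pXn2r. Qed.

Section L2_inner_product.
Context d (T : measurableType d) (R : realType).
Variable mu : {measure set T -> \bar R}.
Implicit Types f g h : T -> R.

Local Notation sqint f := (f \in Lfun mu 2%:E).

Definition ip f g : R := \int[mu]_x (f x * g x).

(** For Lebesgue measure on R^n this is [L2norm] by conversion. *)
Definition nrm f : R := fine 'N[mu]_2%:E[EFin \o f].

Lemma sqint_measurable f : sqint f -> measurable_fun [set: T] f.
Proof. by rewrite inE => /andP[/[!inE]/= mf _]. Qed.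

Lemma sqintE f : sqint f ->
  (\int[mu]_x ((f x) ^+ 2)%:E = (ip f f)%:E)%E.
Proof.
move=> /Lfun2_integrable_sqr fi; rewrite /ip /Rintegral fineK.
  by apply: eq_integral => x _; rewrite expr2.
by apply: integrable_fin_num => //; under eq_fun do rewrite -expr2.
Qed.

Lemma Lnorm2E f :
  ('N[mu]_2%:E[EFin \o f] = (\int[mu]_x ((f x) ^+ 2)%:E) `^ 2^-1)%E.
Proof.
rewrite unlock /Lnorm; congr (_ `^ _)%E; apply: eq_integral => x _ /=.
by rewrite powR_mulrn// real_normK// num_real.
Qed.

Lemma sqintP f : measurable_fun [set: T] f ->
  (\int[mu]_x ((f x) ^+ 2)%:E < +oo)%E -> sqint f.
Proof.
move=> mf fi; rewrite inE; apply/andP; split; rewrite inE//=.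
by rewrite /finite_norm Lnorm2E poweR_lty.
Qed.

Lemma sqint_bound f g : measurable_fun [set: T] f -> sqint g ->
  (forall x, `|f x| <= `|g x|) -> sqint f.
Proof.
move=> mf Lg fg; apply: sqintP => //.
apply: (@le_lt_trans _ _ (\int[mu]_x ((g x) ^+ 2)%:E)%E); last first.
  by rewrite sqintE// ltry.
apply: ge0_le_integral => //.
- by move=> x _; rewrite lee_fin sqr_ge0.
- by apply/measurable_EFinP; exact: measurable_funX.
- apply/measurable_EFinP; apply: measurable_funX; exact: sqint_measurable.
- by move=> x _; rewrite lee_fin ler_sqr_norm.
Qed.

Lemma sqint_mul f g : sqint f -> sqint g ->
  mu.-integrable [set: T] (fun x => (f x * g x)%:E).
Proof. by move=> Lf Lg; have /Lfun1_integrable := Lfun2_mul_Lfun1 Lf Lg. Qed.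

Lemma sqintD f g : sqint f -> sqint g -> sqint (fun x => f x + g x).
Proof. exact: (Lfun_addr_closed mu (lee1n 2)).2. Qed.

Lemma sqintN f : sqint f -> sqint (fun x => - f x).
Proof. exact: Lfun_oppr_closed. Qed.

Lemma sqintZ a f : sqint f -> sqint (fun x => a * f x).
Proof.
move=> Lf; rewrite (_ : (fun _ => _) = a \o* f); first by apply: Lfun_scale => //; rewrite ler1n.
by apply/funext => x /=; rewrite mulrC.
Qed.

Lemma sqintB f g : sqint f -> sqint g -> sqint (fun x => f x - g x).
Proof. by move=> Lf Lg; apply: sqintD => //; exact: sqintN. Qed.

Lemma sqint0 : sqint (fun=> 0 : R).
Proof.
apply: sqintP => //; under eq_integral do rewrite expr0n/=.
by rewrite integral0 ltry.
Qed.

Lemma sqint_sum (I : Type) (r : seq I) (P : pred I) (F : I -> T -> R) :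
  (forall i, P i -> sqint (F i)) -> sqint (fun x => \sum_(i <- r | P i) F i x).
Proof.
move=> LF; elim: r => [|i r IH].
  by under eq_fun do rewrite big_nil; exact: sqint0.
under eq_fun do rewrite big_cons.
by case: (P i) (LF i) => [/(_ isT) Li|_//]; exact: sqintD.
Qed.

Lemma sqint_mul_bounded f g M : sqint f -> measurable_fun [set: T] g ->
  (forall x, `|g x| <= M) -> sqint (fun x => g x * f x).
Proof.
move=> Lf mg gM; apply: (@sqint_bound _ (fun x => M * f x)).
- by apply: measurable_funM => //; exact: sqint_measurable.
- exact: sqintZ.
- move=> x; rewrite !normrM ler_wpM2r//.
  by rewrite (le_trans (gM x))// ler_norm.
Qed.

Lemma ipC f g : ip f g = ip g f.
Proof. by apply: eq_Rintegral => x _; rewrite mulrC. Qed.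

Lemma ipDl f g h : sqint f -> sqint g -> sqint h ->
  ip (fun x => f x + g x) h = ip f h + ip g h.
Proof.
move=> Lf Lg Lh; rewrite /ip -RintegralD//; [|exact: sqint_mul..].
by apply: eq_Rintegral => x _; rewrite mulrDl.
Qed.

Lemma ipZl a f h : sqint f -> sqint h -> ip (fun x => a * f x) h = a * ip f h.
Proof.
move=> Lf Lh; rewrite /ip -RintegralZl//; last exact: sqint_mul.
by apply: eq_Rintegral => x _; rewrite mulrA.
Qed.

Lemma ipNl f h : sqint f -> sqint h -> ip (fun x => - f x) h = - ip f h.
Proof.
move=> Lf Lh; rewrite -mulN1r -ipZl//.
by apply: eq_Rintegral => x _; rewrite mulN1r.
Qed.

Lemma ipBl f g h : sqint f -> sqint g -> sqint h ->
  ip (fun x => f x - g x) h = ip f h - ip g h.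
Proof. by move=> Lf Lg Lh; rewrite ipDl ?ipNl//; exact: sqintN. Qed.

Lemma ipBr f g h : sqint f -> sqint g -> sqint h ->
  ip h (fun x => f x - g x) = ip h f - ip h g.
Proof. by move=> Lf Lg Lh; rewrite ipC ipBl// !(ipC h). Qed.

Lemma ip_suml (I : Type) (r : seq I) (P : pred I) (F : I -> T -> R) h :
  (forall i, P i -> sqint (F i)) -> sqint h ->
  ip (fun x => \sum_(i <- r | P i) F i x) h = \sum_(i <- r | P i) ip (F i) h.
Proof.
move=> LF Lh; elim: r => [|i r IH].
  rewrite big_nil -[RHS](mul0r (ip h h)) -ipZl//.
  by apply: eq_Rintegral => x _; rewrite big_nil !mul0r.
rewrite big_cons -IH; case: ifPn => Pi; last first.
  by apply: eq_Rintegral => x _; rewrite big_cons (negbTE Pi).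
rewrite -ipDl//; [|exact: LF|exact: sqint_sum].
by apply: eq_Rintegral => x _; rewrite big_cons Pi.
Qed.

Lemma ip_ge0 f : 0 <= ip f f.
Proof. by apply: Rintegral_ge0 => x _; rewrite -expr2 sqr_ge0. Qed.

Lemma nrm_ge0 f : 0 <= nrm f.
Proof. by rewrite fine_ge0// Lnorm_ge0. Qed.

Lemma nrm_sqr f : sqint f -> nrm f ^+ 2 = ip f f.
Proof.
move=> Lf; rewrite /nrm Lnorm2E sqintE//= -powR_mulrn ?powR_ge0//.
by rewrite -powRrM mulVf// powRr1// ip_ge0.
Qed.

Lemma cauchy_schwarz f g : sqint f -> sqint g -> `|ip f g| <= nrm f * nrm g.
Proof.
move=> Lf Lg; rewrite -(ler_pXn2r (ltn0Sn 1)) ?nnegrE ?mulr_ge0 ?nrm_ge0//.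
rewrite exprMn !nrm_sqr// real_normK ?num_real//.
have q a b : 0 <= a ^+ 2 * ip f f + (a * b * ip f g) *+ 2 + b ^+ 2 * ip g g.
  have Laf := sqintZ a Lf; have Lbg := sqintZ b Lg.
  have := ip_ge0 (fun x => a * f x + b * g x).
  rewrite ipDl//; last exact: sqintD.
  rewrite !(ipC _ (fun x => a * f x + _)) !ipDl// !ipZl//.
  rewrite (ipC f (fun x => a * f x)) (ipC g (fun x => a * f x)).
  rewrite (ipC f (fun x => b * g x)) (ipC g (fun x => b * g x)).
  rewrite !ipZl// (ipC g f).
  by congr (_ <= _); ring.
have [g0|g0] := eqVneq (ip g g) 0.
  (* With [ip g g = 0] these coefficients give [0 <= - (ip f g)^2 (ip f f + 2)], which forces
     [ip f g = 0]. *)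
  have := q (ip f g) (- (ip f f + 1)); rewrite g0.
  have := ip_ge0 f; have := q 1 1; nra.
have gp : 0 < ip g g by rewrite lt_neqAle eq_sym g0 ip_ge0.
have := q (ip g g) (- ip f g); nra.
Qed.

Lemma nrmD f g : sqint f -> sqint g -> nrm (fun x => f x + g x) <= nrm f + nrm g.
Proof.
move=> Lf Lg; rewrite -(ler_pXn2r (ltn0Sn 1)) ?nnegrE ?addr_ge0 ?nrm_ge0//.
rewrite sqrrD !nrm_sqr//; last exact: sqintD.
rewrite ipDl//; last exact: sqintD.
rewrite !(ipC _ (fun x => f x + _)) !ipDl// (ipC g f).
have := cauchy_schwarz Lf Lg; have := ler_norm (ip f g).
by lra.
Qed.

Lemma nrmZ a f : sqint f -> nrm (fun x => a * f x) = `|a| * nrm f.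
Proof.
move=> Lf; apply/eqP; rewrite -(eqrXn2 (ltn0Sn 1)) ?mulr_ge0 ?nrm_ge0//.
rewrite exprMn !nrm_sqr ?real_normK ?num_real//; last exact: sqintZ.
by rewrite ipZl// 1?ipC ?ipZl//; [rewrite mulrA expr2|exact: sqintZ].
Qed.

Lemma nrmN f : sqint f -> nrm (fun x => - f x) = nrm f.
Proof.
move=> Lf; rewrite (_ : (fun _ => _) = (fun x => -1 * f x)).
  by rewrite nrmZ// normrN1 mul1r.
by apply/funext => x; rewrite mulN1r.
Qed.

Lemma nrmBC f g : sqint f -> sqint g ->
  nrm (fun x => f x - g x) = nrm (fun x => g x - f x).
Proof.
move=> Lf Lg; rewrite -nrmN; last exact: sqintB.
by congr nrm; apply/funext => x; rewrite opprB.
Qed.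

Lemma ler_nrmB f g h : sqint f -> sqint g -> sqint h ->
  nrm (fun x => f x - h x) <=
  nrm (fun x => f x - g x) + nrm (fun x => g x - h x).
Proof.
move=> Lf Lg Lh; rewrite (_ : (fun _ => _) =
    (fun x => (f x - g x) + (g x - h x))); last by apply/funext => x; ring.
by apply: nrmD; exact: sqintB.
Qed.

Lemma eq_ae_ip f f' h : sqint f -> sqint f' -> sqint h ->
  {ae mu, forall x, f x = f' x} -> ip f h = ip f' h.
Proof.
move=> Lf Lf' Lh ff'; congr fine.
apply: ae_eq_integral => //.
- by have /integrableP[] := sqint_mul Lf Lh.
- by have /integrableP[] := sqint_mul Lf' Lh.
- by apply: filterS ff' => x -> _.
Qed.

Lemma eq_ae_nrm f f' : sqint f -> sqint f' ->
  {ae mu, forall x, f x = f' x} -> nrm f = nrm f'.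
Proof.
move=> Lf Lf' ff'; apply/eqP; rewrite -(eqrXn2 (ltn0Sn 1)) ?nrm_ge0//.
by rewrite !nrm_sqr// (@eq_ae_ip f f')// ipC (@eq_ae_ip f f')// ipC.
Qed.

(** Dominated convergence applied to [(F k - f)^2], which is at most [(2 g)^2]; a square root then
    returns to norms. *)
Lemma dominated_nrm (F : (T -> R)^nat) f g : sqint g ->
  (forall k, measurable_fun [set: T] (F k)) ->
  (forall x, F ^~ x @ \oo --> f x) -> (forall k x, `|F k x| <= g x) ->
  sqint f /\ nrm (fun x => F k x - f x) @[k --> \oo] --> 0.
Proof.
move=> Lg mF Ff Fg.
have mf : measurable_fun [set: T] f.
  by apply: (measurable_fun_cvg (h := F)) => // x _; exact: Ff.
have fg x : `|f x| <= g x.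
  have Fx : `|F k x| @[k --> \oo] --> `|f x| by apply: cvg_norm; exact: Ff.
  by apply: (cvgr_to_le Fx); exact: nearW.
have gg x : `|g x| = g x by rewrite ger0_norm// (le_trans _ (fg x)).
have LF k : sqint (F k) by apply: (sqint_bound _ Lg) => // x; rewrite gg.
have Lf : sqint f by apply: (sqint_bound _ Lg) => // x; rewrite gg.
split => //.
have iF k : (\int[mu]_x ((F k x - f x) ^+ 2)%:E =
    (nrm (fun x => F k x - f x) ^+ 2)%:E)%E.
  by rewrite nrm_sqr ?sqintE//; exact: sqintB.
have [| | | | |_ _] := @dominated_convergence _ _ _ mu _ measurableT
  (fun k x => ((F k x - f x) ^+ 2)%:E) (fun=> 0%E)
  (fun x => ((2 * g x) ^+ 2)%:E).
- move=> k; apply/measurable_EFinP; apply: measurable_funX.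
  exact: measurable_funB.
- exact: measurable_cst.
- apply: aeW => x _; apply/fine_cvgP; split; first exact: nearW.
  rewrite -[X in _ --> X](expr0n _ 2) -(subrr (f x)).
  have Fx : F k x - f x @[k --> \oo] --> f x - f x.
    by apply: cvgB; [exact: Ff|exact: cvg_cst].
  exact: (cvgM Fx Fx).
- by have := Lfun2_integrable_sqr (sqintZ 2 Lg).
- apply: aeW => x k _; rewrite gee0_abs ?lee_fin ?sqr_ge0// ler_sqr_norm//.
  by rewrite normrM gg ger0_norm// (le_trans (ler_normB _ _))// mulr2n mulrDl
    mul1r lerD.
rewrite integral0; under eq_fun do rewrite iF.
move=> /fine_cvgP[_ H].
have -> : 0 = Num.sqrt 0 :> R by rewrite sqrtr0.
under eq_fun do rewrite -[nrm _]ger0_norm ?nrm_ge0// -sqrtr_sqr.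
by apply: continuous_cvg => //; exact: sqrt_continuous.
Qed.

End L2_inner_product.

(** * Lebesgue measure on R^n *)

Section boxes.
Context {R : realType} {n : nat}.
Local Notation mu := (lebesgue_rV n : {measure set 'rV[R]_n -> \bar R}).

(** Half-open sides match the intervals [ocitv] that generate the sigma-algebra of R. Degenerate
    boxes are allowed, so that intersections are again boxes. *)
Definition box (a b : 'I_n -> R) : set 'rV[R]_n :=
  [set x | forall i, x ord0 i \in `]a i, b i]].

Definition boxes : set (set 'rV[R]_n) := [set box ab.1 ab.2 | ab in setT].

Definition cube (k : nat) : set 'rV[R]_n :=
  box (fun=> - k%:R) (fun=> k%:R).

Lemma boxes_setI : setI_closed boxes.
Proof.
move=> _ _ [[a b] _ <-] [[c d] _ <-] /=.
exists (fun i => Num.max (a i) (c i), fun i => Num.min (b i) (d i)) => //=.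
apply/seteqP; split => x /=.
  move=> xab; split => i; move: (xab i); rewrite !in_itv/= gt_max le_min.
    by move=> /andP[/andP[-> _] /andP[-> _]].
  by move=> /andP[/andP[_ ->] /andP[_ ->]].
move=> [xab xcd] i; move: (xab i) (xcd i); rewrite !in_itv/= gt_max le_min.
by move=> /andP[-> ->] /andP[-> ->].
Qed.

Lemma measurable_coords (A : 'I_n -> set R) :
  (forall i, measurable (A i)) ->
  measurable [set x : 'rV[R]_n | forall i, A i (x ord0 i)].
Proof.
move=> mA; rewrite (_ : [set _ | _] =
    \bigcap_(i in [set: 'I_n]) [set x : 'rV[R]_n | A i (x ord0 i)]).
  apply: fin_bigcap_measurable => // i _.
  by rewrite -[X in measurable X]setTI; apply: measurable_coord.
by apply/seteqP; split => x /= h i; [move=> _|]; apply: h.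
Qed.

Lemma measurable_box a b : measurable (box a b).
Proof.
apply: (@measurable_coords (fun i => `]a i, b i]%classic)) => i.
exact: measurable_itv.
Qed.

Lemma lebesgue_boxE a b :
  mu (box a b) = (\prod_(i < n) lebesgue_measure `]a i, b i]%classic)%E.
Proof.
apply: (@lebesgue_rV_box _ _ (fun i => `]a i, b i]%classic)) => i.
exact: measurable_itv.
Qed.

Lemma cube_exists (x : 'rV[R]_n) : exists k, forall m, (k <= m)%N -> cube m x.
Proof.
have [k xk] : exists k, forall i, `|x ord0 i| < k%:R.
  exists (Num.trunc (\sum_i `|x ord0 i|)).+1 => i.
  rewrite (le_lt_trans _ (truncnS_gt _))//.
  by rewrite (bigD1 i)//= lerDl sumr_ge0.
exists k => m km i; rewrite /= in_itv/=; have := xk i.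
have : k%:R <= m%:R :> R by rewrite ler_nat.
rewrite ltr_norml => km' /andP[x1 x2]; apply/andP; split; lra.
Qed.

Lemma bigcup_cube : \bigcup_k cube k = setT.
Proof.
apply/seteqP; split => // x _; have [k xk] := cube_exists x.
by exists k => //; apply: xk.
Qed.

Lemma measurable_rV_boxes : measurable = <<s boxes >> :> set (set 'rV[R]_n).
Proof.
apply/seteqP; split; last first.
  apply: smallest_sub; first exact: sigma_algebra_measurable.
  by move=> _ [[a b] _ <-]; exact: measurable_box.
apply: smallest_sub; first exact: smallest_sigma_algebra.
rewrite -bigcup_seq; apply: bigcup_sub => i _ _ [B mB <-].
suff : measurable_fun [set: g_sigma_algebraType boxes]
    (fun x : g_sigma_algebraType boxes => (x : 'rV[R]_n) ord0 i) by exact.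
apply: (measurability (@ocitv R)) => // _ [_ [[a b] _ <-] <-].
(* The slab where coordinate [i] lies in the interval is exhausted by boxes whose other sides are
   those of [cube k]. *)
rewrite setTI (_ : _ @^-1` _ = \bigcup_k
    box (fun j => if j == i then a else - k%:R)
        (fun j => if j == i then b else k%:R)).
  apply: bigcup_measurable => k _; apply: sub_sigma_algebra.
  by eexists (_, _).
apply/seteqP; split => x /=.
  move=> xab; have [k xk] := cube_exists x; exists k => // j /=.
  by case: eqP => [->//|_]; exact: (xk k).
by move=> [k _ /(_ i)]; rewrite eqxx.
Qed.

Lemma lebesgue_box_lty a b : (mu (box a b) < +oo)%E.
Proof.
rewrite lebesgue_boxE ltey_eq prode_fin_num// => i _.
rewrite lebesgue_measure_itv/=; case: ifP => // _.
Qed.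

Lemma measurable_shift (v : 'rV[R]_n) :
  measurable_fun [set: 'rV[R]_n] (fun x => x + v).
Proof.
apply: measurable_fun_rVP => i; under eq_fun do rewrite mxE.
by apply: measurable_funD => //; exact: measurable_coord.
Qed.

(** Uniqueness of measures on a pi-system: both sides agree on boxes, since translation preserves
    side lengths, and the cubes exhaust the space with finite measure. *)
Lemma lebesgue_rV_shift (v : 'rV[R]_n) A : measurable A ->
  mu ((fun x => x + v) @^-1` A) = mu A.
Proof.
have := @measurable_shift v.
move=> mv mA.
apply: (@measure_unique _ _ _ boxes cube measurable_rV_boxes boxes_setI _ _
  (measure_function_pushforward__canonical__measure_function_Measure mu mv)
  mu _ _ A mA).
- by move=> k; eexists (_, _).
- exact: bigcup_cube.
- move=> _ [[a b] _ <-] /=; rewrite /pushforward.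
  rewrite (_ : _ @^-1` _ = box (fun i => a i - v ord0 i) (fun i => b i - v ord0 i)).
    rewrite !lebesgue_boxE; apply: eq_bigr => i _; rewrite !lebesgue_measure_itv/= !lte_fin ltrD2r.
    by case: ifP => // _; rewrite -!EFinB; congr EFin; ring.
  apply/seteqP; split => x /= xab i; have := xab i; rewrite /= !in_itv/= mxE.
    by rewrite ltrBlDr lerBrDr.
  by rewrite ltrBlDr lerBrDr.
- move=> k; rewrite /= /pushforward.
  rewrite (_ : _ @^-1` _ = box (fun i => - k%:R - v ord0 i) (fun i => k%:R - v ord0 i)).
    exact: lebesgue_box_lty.
  apply/seteqP; split => x /= xab i; have := xab i; rewrite /= !in_itv/= mxE.
    by rewrite ltrBlDr lerBrDr.
  by rewrite ltrBlDr lerBrDr.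
Qed.

Lemma integral_shift (v : 'rV[R]_n) (f : 'rV[R]_n -> \bar R) :
  measurable_fun [set: 'rV[R]_n] f ->
  (\int[mu]_x f (x + v)%R = \int[mu]_x f x)%E.
Proof.
have mv := @measurable_shift v.
have ge0 g : measurable_fun [set: 'rV[R]_n] g -> (forall x, 0 <= g x)%E ->
    (\int[mu]_x g (x + v)%R = \int[mu]_x g x)%E.
  move=> mg g0; have := ge0_integral_pushforward mv mu measurableT mg.
  rewrite preimage_setT => <-; last by move=> x _; exact: g0.
  by apply: eq_measure_integral => A mA _; exact: lebesgue_rV_shift.
move=> mf; rewrite integralE [RHS]integralE.
congr (_ - _)%E.
  transitivity (\int[mu]_x f^\+ (x + v)%R)%E.
    by apply: eq_integral => x _; rewrite !unlock.
  apply: ge0; first exact: measurable_funepos.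
  by move=> x; exact: funepos_ge0.
transitivity (\int[mu]_x f^\- (x + v)%R)%E.
  by apply: eq_integral => x _; rewrite !unlock.
apply: ge0; first exact: measurable_funeneg.
by move=> x; exact: funeneg_ge0.
Qed.

(** An open set is the union of the sup-norm balls with rational centre and radius [1/(k+1)] that it
    contains, and these are countably many. *)
Lemma measurable_rV_open (U : set 'rV[R]_n) : open U -> measurable U.
Proof.
move=> oU.
pose B (p : 'rV[rat]_n * nat) : set 'rV[R]_n :=
  [set x | forall i, ball (ratr (p.1 ord0 i) : R) p.2.+1%:R^-1 (x ord0 i)].
have mB p : measurable (B p).
  apply: (@measurable_coords (fun i => ball (ratr (p.1 ord0 i) : R) p.2.+1%:R^-1)).
  by move=> i; exact: measurable_ball.
rewrite (_ : U = \bigcup_(p in [set p | B p `<=` U]) B p).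
  rewrite bigcup_mkcond; apply: countable_bigcupT_measurable => // p.
  by case: ifP.
apply/seteqP; split => x; last by move=> [p pU]; exact: pU.
move=> Ux; have /nbhs_ballP[e /= e0 eU] := open_nbhs_nbhs (conj oU Ux).
(* Going from [x] to a point of the small ball passes through the rational centre and costs two
   radii, so [2/(k+1) < e] is required. *)
pose k := Num.trunc (2 / e).
have ke : k.+1%:R^-1 + k.+1%:R^-1 < e.
  have := truncnS_gt (2 / e); rewrite -/k ltr_pdivrMr//.
  have k0 : 0 < k.+1%:R :> R by rewrite ltr0n.
  by move=> H; rewrite -mulr2n -[_ *+ 2]mulr_natl ltr_pdivrMr// mulrC.
have qx i : exists q : rat, ball (ratr q : R) k.+1%:R^-1 (x ord0 i).
  have [|q] := @rat_in_itvoo R (x ord0 i - k.+1%:R^-1) (x ord0 i + k.+1%:R^-1).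
    by rewrite ltrD2l gtrN// invr_gt0 ltr0n.
  rewrite in_itv/= => /andP[q1 q2]; exists q.
  by rewrite /ball/= ltr_distl q1 q2.
have {qx}[q xq] := choice qx.
exists (\row_i q i, k) => [y/= yB|i]; last by rewrite /= mxE.
apply: eU; rewrite /ball/=; split => // i j; rewrite (ord1 i).
move: (yB j) (xq j); rewrite mxE => b1 b2.
apply: (le_ball (ltW ke)).
by apply: ball_triangle b1; exact: ball_sym.
Qed.

Lemma continuous_measurable_rV (f : 'rV[R]_n -> R) :
  continuous f -> measurable_fun [set: 'rV[R]_n] f.
Proof.
move=> cf; apply: (measurability (@RGenOpens.G R)).
  exact: RGenOpens.measurableE.
move=> _ [_ [a [b ->]] <-]; rewrite setTI; apply: measurable_rV_open.
move/continuousP : cf; apply; exact: interval_open.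
Qed.

End boxes.

(** * Smooth functions *)

Section flat.
Context {R : realType}.
Implicit Types (p : {poly R}) (t : R).

(* The functions [p (1 / t) exp (- 1 / t)], extended by 0 for [t <= 0], are
   closed under differentiation, hence smooth. *)
Definition flat p t : R := if 0 < t then p.[t^-1] * expR (- t^-1) else 0.

(** With [y = 1/t] one has [dy/dt = - y^2], so the exponential contributes [y^2 p] and the
    polynomial [- y^2 p']. *)
Definition flat_deriv p : {poly R} := 'X^2 * (p - p^`()).

Lemma flat_gt0 p t : 0 < t -> flat p t = p.[t^-1] * expR (- t^-1).
Proof. by rewrite /flat => ->. Qed.

Lemma flat_le0 p t : t <= 0 -> flat p t = 0.
Proof. by rewrite /flat leNgt => /negbTE ->. Qed.

Lemma horner_bound p (y : R) : 1 <= y ->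
  `|p.[y]| <= (\sum_(i < size p) `|p`_i|) * y ^+ size p.
Proof.
move=> y1; rewrite horner_coef (le_trans (ler_norm_sum _ _ _))// mulr_suml.
apply: ler_sum => i _; rewrite normrM ler_wpM2l// normrX.
rewrite ger0_norm ?(le_trans ler01)//.
by apply: ler_weXn2l => //; exact: ltnW.
Qed.

(** This makes the difference quotient at 0 vanish in the limit. With [y = 1/t] and [m = size p],
    the bound [exp y >= y^(m+2) / (m+2)!] absorbs the growth [y^m] of the polynomial and leaves a
    factor [t^2]. *)
Lemma flat_bound p : exists2 C : R, 0 <= C &
  forall t, `|t| <= 1 -> `|flat p t| <= C * t ^+ 2.
Proof.
pose m := size p; pose A := \sum_(i < m) `|p`_i|.
have A0 : 0 <= A by apply: sumr_ge0.
exists (A * m.+2`!%:R) => [|t t1]; first by rewrite mulr_ge0.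
have [t0|t0] := leP t 0.
  by rewrite flat_le0// normr0 mulr_ge0 ?sqr_ge0// mulr_ge0.
rewrite flat_gt0// normrM (ger0_norm (expR_ge0 _)) expRN.
rewrite ger0_norm ?(ltW t0)// in t1.
have y1 : 1 <= t^-1 by rewrite invf_ge1.
have y0 : 0 < t^-1 by rewrite invr_gt0.
rewrite ler_pdivrMr ?expR_gt0//.
have := expR_ge1Dxn m.+1 (ltW y0).
set E := expR _ => HE.
apply: (le_trans (horner_bound p y1)); rewrite -/m -/A.
have f0 : 0 < m.+2`!%:R :> R by rewrite ltr0n fact_gt0.
have {}HE : t^-1 ^+ m.+2 <= m.+2`!%:R * E.
  by rewrite mulrC -ler_pdivrMr// (le_trans _ HE)// lerDr.
have -> : t^-1 ^+ m = t ^+ 2 * t^-1 ^+ m.+2.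
  have tV : t * t^-1 = 1 by rewrite divff ?gt_eqF.
  rewrite (exprS _ m.+1) (exprS _ m); transitivity ((t * t^-1) ^+ 2 * t^-1 ^+ m).
    by rewrite tV expr1n mul1r.
  ring.
rewrite (_ : A * _ * _ * E = A * (t ^+ 2 * (m.+2`!%:R * E))); last by ring.
by rewrite ler_wpM2l// ler_wpM2l ?sqr_ge0.
Qed.

Lemma is_derive_flat p t : is_derive t 1 (flat p) (flat (flat_deriv p) t).
Proof.
have [t0|t0|->] := ltgtP t 0.
- rewrite (flat_le0 _ (ltW t0)).
  apply: (near_eq_is_derive _ (is_derive_cst (0 : R) t 1)).
  by near=> s; rewrite flat_le0// ltW//; near: s; exact: lt_nbhsl.
- rewrite flat_gt0//.
  have dV : is_derive t 1 (fun s : R => s^-1) (- t ^- 2 *: 1).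
    by apply: is_deriveV; rewrite gt_eqF.
  have dp : is_derive t 1 (fun s : R => p.[s^-1])
      (p^`().[t^-1] * (- t ^- 2 *: 1)).
    exact: (@is_derive1_comp _ (horner p) (fun s : R => s^-1)).
  have de : is_derive t 1 (fun s : R => expR (- s^-1))
      (expR (- t^-1) * - (- t ^- 2 *: 1)).
    exact: (@is_derive1_comp _ expR (fun s : R => - s^-1)).
  have dpe := is_deriveM dp de.
  rewrite (_ : _ * _ = p.[t^-1] *: (expR (- t^-1) * - (- t ^- 2 *: 1)) +
      expR (- t^-1) *: (p^`().[t^-1] * (- t ^- 2 *: 1))).
    apply: (near_eq_is_derive _ dpe).
    by near=> s; rewrite flat_gt0//; near: s; exact: lt_nbhsr.
  by rewrite /flat_deriv !hornerE/= /GRing.scale/= exprVn; ring.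
- rewrite flat_le0//.
  have [C C0 HC] := flat_bound p.
  have H : (fun h => h^-1 *: ((flat p \o shift 0) (h *: 1) - flat p 0)) @ 0^'
      --> (0 : R).
    apply/cvgr0Pnorm_le => e e0.
    near=> h.
    have h0 : h != 0 by near: h; exact: nbhs_dnbhs_neq.
    rewrite /= addr0 (flat_le0 _ (lexx 0)) subr0 /GRing.scale/= mulr1 normrM normfV.
    have h1 : `|h| <= 1.
      by near: h; apply: dnbhs0_le.
    (* The [+ 1] keeps the denominator positive when [C = 0]. *)
    have h2 : `|h| <= e / (C + 1).
      by near: h; apply: dnbhs0_le; rewrite divr_gt0// ltr_wpDl.
    rewrite ler_pdivrMl ?normr_gt0//.
    apply: (le_trans (HC h h1)); rewrite -real_normK ?num_real// expr2 mulrCA.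
    rewrite ler_wpM2l//.
    move: h2; rewrite ler_pdivlMr ?ltr_wpDl//.
    have := normr_ge0 h; nra.
  by apply: DeriveDef; [apply/cvg_ex; exists 0|exact: cvg_lim].
Unshelve. all: by end_near. Qed.

Lemma flat1_ge0 t : 0 <= flat 1 t.
Proof. by rewrite /flat; case: ifP => // _; rewrite hornerE mul1r expR_ge0. Qed.

Lemma flat1_le1 t : flat 1 t <= 1.
Proof.
rewrite /flat; case: ifP => // t0; rewrite hornerE mul1r expR_le1.
by rewrite oppr_le0 invr_ge0 ltW.
Qed.

Lemma flat1_ge t : 0 < t -> 1 - t^-1 <= flat 1 t.
Proof. by move=> t0; rewrite flat_gt0// hornerE mul1r expR_ge1Dx. Qed.

End flat.

(** * Stability of smoothness under sums, products and affine functions of a coordinate *)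

Section smooth_algebra.
Context {R : realType} {n : nat}.
Implicit Types (f g phi : 'rV[R]_n -> R) (s : seq 'I_n).

Local Notation e_ i := (delta_mx ord0 i : 'rV[R]_n).

(** [smooth] graded by order. The derivative peeled off here is the one taken first, next to [f],
    whereas the head of the list in [pderivs] is taken last; thus the sum and product rules feed
    directly into an induction on [k]. *)
Fixpoint smoothn k f : Prop :=
  [/\ continuous f, forall i x, derivable f x (e_ i) &
      if k is k'.+1 then forall i, smoothn k' (pderiv i f) else True].

Lemma smoothP f : smooth f <-> forall k, smoothn k f.
Proof.
split=> [+ k|fk s].
  elim: k f => [|k IH] f fs; first by split => //; have [] := fs [::].
  have [cf df] := fs [::]; split=> // i; apply: IH => s.
  by have := fs (rcons s i); rewrite /pderivs foldr_rcons.
have := fk (size s) => {fk}; elim/last_ind: s f => [|s i IH] f; first by case.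
by rewrite size_rcons => -[_ _ /(_ i)/IH]; rewrite /pderivs foldr_rcons.
Qed.

Lemma smooth_pderiv i f : smooth f -> smooth (pderiv i f).
Proof. by move=> fs s; have := fs (rcons s i); rewrite /pderivs foldr_rcons. Qed.

Lemma smooth_continuous f : smooth f -> continuous f.
Proof. by move=> /(_ [::])[]. Qed.

Lemma smooth_derivable f i x : smooth f -> derivable f x (e_ i).
Proof. by move=> /(_ [::])[]. Qed.

Lemma smoothn_le k f : smoothn k.+1 f -> smoothn k f.
Proof.
elim: k f => [|k IH] f [cf df pf]; first by split.
by split => // i; apply: IH; exact: pf.
Qed.

Lemma smoothnD k f g : smoothn k f -> smoothn k g ->
  smoothn k (fun x => f x + g x).
Proof.
elim: k f g => [|k IH] f g [cf df pf] [cg dg pg].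
  by split=> // [x|i x]; [exact: cvgD (cf x) (cg x)|exact: derivableD].
split=> [x|i x|i]; [exact: cvgD (cf x) (cg x)|exact: derivableD|].
rewrite (_ : pderiv i _ = fun x => pderiv i f x + pderiv i g x).
  exact: (IH _ _ (pf i) (pg i)).
by apply/funext => x; rewrite /pderiv (deriveD (df _ _) (dg _ _)).
Qed.

Lemma smoothnM k f g : smoothn k f -> smoothn k g ->
  smoothn k (fun x => f x * g x).
Proof.
elim: k f g => [|k IH] f g [cf df pf] [cg dg pg].
  by split=> // [x|i x]; [exact: cvgM (cf x) (cg x)|exact: derivableM].
split=> [x|i x|i]; [exact: cvgM (cf x) (cg x)|exact: derivableM|].
rewrite (_ : pderiv i _ = fun x => f x * pderiv i g x + g x * pderiv i f x).
  apply: smoothnD; first by apply: (IH _ _ _ (pg i)); exact: smoothn_le.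
  by apply: (IH _ _ _ (pf i)); exact: smoothn_le.
by apply/funext => x; rewrite /pderiv (deriveM (df _ _) (dg _ _)).
Qed.

Lemma smoothn_cst k (c : R) : smoothn k (fun=> c).
Proof.
elim: k c => [|k IH] c.
  by split=> //; exact: cst_continuous.
split=> [|//|i]; first exact: cst_continuous.
rewrite (_ : pderiv i _ = fun=> 0); first exact: IH.
by apply/funext => x; exact: derive_cst.
Qed.

Lemma smoothn_prod k (I : Type) (r : seq I) (F : I -> 'rV[R]_n -> R) :
  (forall i, smoothn k (F i)) -> smoothn k (fun x => \prod_(i <- r) F i x).
Proof.
move=> sF; elim: r => [|i r IH].
  by under eq_fun do rewrite big_nil; exact: smoothn_cst.
by under eq_fun do rewrite big_cons; exact: smoothnM.
Qed.

Lemma is_derive_lineP f x v (d : R) :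
  is_derive (0 : R) 1 (fun h : R => f (h *: v + x)) d -> is_derive x v f d.
Proof.
move=> [df <-]; apply: DeriveDef; first exact/derivable1P.
rewrite /derive (_ : (fun h => h^-1 *: ((f \o shift x) (h *: v) - f x)) =
  (fun h => h^-1 *: (((fun h : R => f (h *: v + x)) \o shift 0) (h *: 1) -
    f (0 *: v + x))))//.
by apply/funext => h /=; rewrite addr0 scale0r add0r [h *: 1]mulr1.
Qed.

Lemma is_derive_flat_coord (p : {poly R}) (a b : R) (j i : 'I_n) x :
  is_derive x (e_ i) (fun x => flat p (a * x ord0 j + b))
    ((a * (i == j)%:R) * flat (flat_deriv p) (a * x ord0 j + b)).
Proof.
apply: is_derive_lineP.
rewrite (_ : (fun _ => _) = flat p \o
    (fun h : R => (a * (i == j)%:R) * h + (a * x ord0 j + b))); last first.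
  by apply/funext => h /=; rewrite !mxE eqxx/= eq_sym; congr flat; ring.
pose g (h : R) := (a * (i == j)%:R) * h + (a * x ord0 j + b).
have dg : is_derive (0 : R) 1 g (a * (i == j)%:R).
  apply: DeriveDef => //; rewrite /g deriveD// derive_cst addr0.
  by rewrite deriveMl// derive_id mulr1.
have df := is_derive_flat p (g 0).
have := is_derive1_comp (g := g) df dg.
have g0 : g 0 = a * x ord0 j + b by rewrite /g mulr0 add0r.
by rewrite g0 mulrC.
Qed.

Lemma smoothn_flat_coord k (p : {poly R}) (a b : R) (j : 'I_n) :
  smoothn k (fun x => flat p (a * x ord0 j + b)).
Proof.
have cF q : continuous (fun x : 'rV[R]_n => flat q (a * x ord0 j + b)).
  move=> x; apply: (@continuous_comp _ _ _
    (fun x : 'rV[R]_n => a * x ord0 j + b) (flat q)).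
    apply: continuousD; last exact: cst_continuous.
    by apply: continuousM; [exact: cst_continuous|exact: coord_continuous].
  apply/differentiable_continuous/derivable1_diffP.
  by have [] := is_derive_flat q (a * x ord0 j + b).
elim: k p => [|k IH] p.
  by split=> // i x; have [] := is_derive_flat_coord p a b j i x.
split=> // [i x|i]; first by have [] := is_derive_flat_coord p a b j i x.
rewrite (_ : pderiv i _ = fun x => (a * (i == j)%:R) *
    flat (flat_deriv p) (a * x ord0 j + b)).
  by apply: smoothnM; [exact: smoothn_cst|exact: IH].
apply/funext => x; rewrite /pderiv.
by have [_ ->] := is_derive_flat_coord p a b j i x.
Qed.

End smooth_algebra.

(** * Test functions: supports, translates, bounds and square integrability *)

Section test_functions.
Context {R : realType} {n : nat}.
Implicit Types (f g phi : 'rV[R]_n -> R) (s : seq 'I_n).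
Local Notation mu := (lebesgue_rV n : {measure set 'rV[R]_n -> \bar R}).
Local Notation e_ i := (delta_mx ord0 i : 'rV[R]_n).

Lemma le_coord_norm (x : 'rV[R]_n) i : `|x ord0 i| <= `|x|.
Proof.
rewrite [leRHS]/Num.norm /= mx_normrE.
by apply/bigmax_geP; right => /=; exists (ord0, i).
Qed.

Lemma rV_norm_le (x : 'rV[R]_n) M : 0 <= M ->
  (forall i, `|x ord0 i| <= M) -> `|x| <= M.
Proof.
move=> M0 xM; rewrite [leLHS]/Num.norm /= mx_normrE.
by apply/bigmax_leP; split => // -[i j] _ /=; rewrite (ord1 i).
Qed.

Lemma norm_delta_mx (i : 'I_n) : `|e_ i| <= 1 :> R.
Proof.
apply: rV_norm_le => // j; rewrite mxE eqxx/=.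
by case: eqP => _; rewrite ?normr1 ?normr0.
Qed.

Lemma norm_le_cube (M : R) : exists k, forall x : 'rV[R]_n, `|x| <= M -> cube k x.
Proof.
exists (Num.trunc M).+1 => x xM i; rewrite in_itv/=.
have : `|x ord0 i| < (Num.trunc M).+1%:R.
  by rewrite (le_lt_trans (le_coord_norm x i))// (le_lt_trans xM)// truncnS_gt.
by rewrite ltr_norml => /andP[-> /ltW ->].
Qed.

Lemma closed_norm_le (M : R) : closed [set x : 'rV[R]_n | `|x| <= M].
Proof.
apply: (@closed_comp _ _ (fun x : 'rV[R]_n => `|x|) [set r | r <= M]).
  by move=> x _; exact: norm_continuous.
exact: closed_le.
Qed.

Lemma compact_norm_le (M : R) : compact [set x : 'rV[R]_n | `|x| <= M].
Proof.
apply: (bounded_closed_compact _ (@closed_norm_le M)).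
exists M; split; first exact: num_real.
by move=> N MN x /= xM; rewrite (le_trans xM)// ltW.
Qed.

Lemma test_functionP phi : test_function phi <->
  smooth phi /\ exists M, forall x, phi x != 0 -> `|x| <= M.
Proof.
split=> -[sphi].
  move=> /compact_bounded[M [_ HM]]; split=> //; exists (M + 1) => x px.
  by apply: HM; [rewrite ltrDl|exact: subset_closure].
move=> [M HM]; split=> //.
apply: (subclosed_compact _ (@compact_norm_le M)); first exact: closed_closure.
rewrite ((closure_id _).1 (@closed_norm_le M)).
exact: closure_subset.
Qed.

Lemma test_function_smooth phi : test_function phi -> smooth phi.
Proof. by case. Qed.

Lemma test_function_pderiv i phi : test_function phi ->
  test_function (pderiv i phi).
Proof.
move=> /test_functionP[sphi [M HM]]; apply/test_functionP.
split; first exact: smooth_pderiv.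
exists M => x; apply: contraNT; rewrite -ltNge => Mx.
(* Beyond radius [M] the function vanishes on a whole neighbourhood of [x], hence so does its
   derivative at [x]. *)
rewrite /pderiv (@near_eq_derive _ _ _ _ (cst 0)) ?derive_cst//.
have : open [set y : 'rV[R]_n | M < `|y|].
  rewrite (_ : [set _ | _] = ~` [set y | `|y| <= M]).
    exact/closed_openC/closed_norm_le.
  by apply/seteqP; split => y /=; rewrite ltNge => /negP.
move=> oM; have : nbhs x [set y : 'rV[R]_n | M < `|y|] by apply: open_nbhs_nbhs; split.
apply: filterS => y /= My; apply: contraTeq My.
by rewrite -leNgt; exact: HM.
Qed.

Lemma test_functionD f g : test_function f -> test_function g ->
  test_function (fun x => f x + g x).
Proof.
move=> /test_functionP[sf [M HM]] /test_functionP[sg [N HN]].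
apply/test_functionP; split.
  by apply/smoothP => k; apply: smoothnD; exact: (smoothP _).1.
exists (Num.max M N) => x; rewrite le_max.
have [fx|/HM -> //] := eqVneq (f x) 0.
by rewrite fx add0r => /HN ->; rewrite orbT.
Qed.

Lemma test_functionZ (c : R) f : test_function f ->
  test_function (fun x => c * f x).
Proof.
move=> /test_functionP[sf [M HM]]; apply/test_functionP; split.
  apply/smoothP => k; apply: smoothnM; first exact: smoothn_cst.
  exact: (smoothP _).1.
by exists M => x; rewrite mulf_eq0 negb_or => /andP[_ /HM].
Qed.

Lemma derive_translate f (v w x : 'rV[R]_n) :
  'D_w (fun y => f (y + v)) x = 'D_w f (x + v).
Proof.
rewrite /derive (_ : (fun h => h^-1 *: (((fun y => f (y + v)) \o shift x) (h *: w)
    - f (x + v))) = (fun h => h^-1 *: ((f \o shift (x + v)) (h *: w) - f (x + v))))//.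
by apply/funext => h /=; rewrite addrA.
Qed.

Lemma derivable_translate f (v w x : 'rV[R]_n) :
  derivable f (x + v) w -> derivable (fun y => f (y + v)) x w.
Proof.
rewrite /derivable (_ : (fun h => h^-1 *: (((fun y => f (y + v)) \o shift x) (h *: w)
    - f (x + v))) = (fun h => h^-1 *: ((f \o shift (x + v)) (h *: w) - f (x + v))))//.
by apply/funext => h /=; rewrite addrA.
Qed.

Lemma pderivs_translate s f (v : 'rV[R]_n) :
  pderivs s (fun y => f (y + v)) = fun y => pderivs s f (y + v).
Proof.
elim: s => //= i s ->; apply/funext => x.
by rewrite /pderiv derive_translate.
Qed.

Lemma test_function_translate f (v : 'rV[R]_n) : test_function f ->
  test_function (fun y => f (y + v)).
Proof.
move=> /test_functionP[sf [M HM]]; apply/test_functionP; split=> [s|].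
  rewrite pderivs_translate; have [cf df] := sf s; split=> [x|i x].
    apply: (@continuous_comp _ _ _ (fun y : 'rV[R]_n => y + v) (pderivs s f)).
      by apply: continuousD; [move=> A|exact: cst_continuous].
    exact: cf.
  by apply: derivable_translate.
exists (M + `|v|) => x /HM xM.
by rewrite -[x](addrK v) (le_trans (ler_normB _ _))// lerD2r.
Qed.

Lemma test_function_bounded phi : test_function phi ->
  exists M B : R, [/\ 0 <= B, forall x, `|phi x| <= B &
    forall x, M < `|x| -> phi x = 0].
Proof.
move=> /test_functionP[sphi [M HM]].
have cphi := smooth_continuous sphi.
have : compact (phi @` [set x : 'rV[R]_n | `|x| <= M]).
  apply: (continuous_compact _ (@compact_norm_le M)).
  exact: continuous_subspaceT.
move=> /compact_bounded[B [_ HB]].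
exists M, (`|B| + 1); split=> [|x|x Mx].
- by rewrite addr_ge0.
- have [->|/HM xM] := eqVneq (phi x) 0; first by rewrite normr0 addr_ge0.
  by apply: HB; [rewrite ltr_pwDr// ler_norm|exists x].
- by apply: contraTeq Mx; rewrite -leNgt; exact: HM.
Qed.

Lemma sqint_indic (A : set 'rV[R]_n) : measurable A -> (mu A < +oo)%E ->
  \1_A \in Lfun mu 2%:E.
Proof.
move=> mA Aoo; apply: sqintP; first exact: measurable_indic.
under eq_integral => x _.
  rewrite indicE -natrX -[(_ ^ 2)%N]/((x \in A) * (x \in A))%N mulnb andbb -indicE.
  over.
by rewrite integral_indic// setIT.
Qed.

Lemma sqint_indic_cube k : (\1_(cube k) : 'rV[R]_n -> R) \in Lfun mu 2%:E.
Proof.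
apply: sqint_indic; [exact: measurable_box|exact: lebesgue_box_lty].
Qed.

Lemma test_function_measurable phi : test_function phi ->
  measurable_fun [set: 'rV[R]_n] phi.
Proof.
move=> [sphi _]; apply: continuous_measurable_rV; exact: smooth_continuous.
Qed.

Lemma test_function_sqint phi : test_function phi -> phi \in Lfun mu 2%:E.
Proof.
move=> tphi; have [M [B [B0 HB HM]]] := test_function_bounded tphi.
have [k Hk] := norm_le_cube M.
apply: (@sqint_bound _ _ _ _ _ (fun x => B * \1_(cube k) x)).
- exact: test_function_measurable.
- exact/sqintZ/sqint_indic_cube.
- move=> x; have [xM|/HM ->] := leP `|x| M; last by rewrite normr0.
  by rewrite indicE mem_set ?mulr1 ?(ger0_norm B0)//; exact: Hk.
Qed.

End test_functions.

(** * Density of test functions in L2 *)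

Lemma nrm0 d (T : measurableType d) (R : realType)
  (mu : {measure set T -> \bar R}) : nrm mu (fun=> 0 : R) = 0.
Proof.
have := nrmZ 0 (sqint0 mu); rewrite normr0 [RHS]mul0r => H.
by rewrite -[RHS]H; congr nrm; apply/funext => x; rewrite mul0r.
Qed.

Section bumps.
Context {R : realType} {n : nat}.
Local Notation mu := (lebesgue_rV n : {measure set 'rV[R]_n -> \bar R}).

Lemma cvg_prod_seq (I : Type) (r : seq I) (F : I -> nat -> R) (a : I -> R) :
  (forall i, F i k @[k --> \oo] --> a i) ->
  \prod_(i <- r) F i k @[k --> \oo] --> \prod_(i <- r) a i.
Proof.
move=> Fa; elim: r => [|i r IH].
  by rewrite big_nil; under eq_fun do rewrite big_nil; exact: cvg_cst.
by rewrite big_cons; under eq_fun do rewrite big_cons; apply: cvgM.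
Qed.

(** Squeezed between [1 - 1/(t (k+1))], which comes from [flat1_ge], and 1. *)
Lemma cvg_flat1 (a : nat -> R) (t : R) : 0 < t ->
  (forall k, t * k.+1%:R <= a k) -> flat 1 (a k) @[k --> \oo] --> (1 : R).
Proof.
move=> t0 ta.
have H : 1 - t^-1 * k.+1%:R^-1 @[k --> \oo] --> (1 : R).
  rewrite -[X in _ --> X]subr0; apply: cvgB; first exact: cvg_cst.
  rewrite -[X in _ --> X](mulr0 t^-1); apply: cvgM; first exact: cvg_cst.
  exact: cvg_harmonic.
apply: (squeeze_cvgr _ H (cvg_cst (1 : R))).
apply: nearW => k; rewrite flat1_le1 andbT.
have k0 : 0 < t * k.+1%:R by rewrite mulr_gt0.
have a0 : 0 < a k by rewrite (lt_le_trans k0).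
by rewrite (le_trans _ (flat1_ge a0))// lerD2l lerN2 -invfM lef_pV2 ?posrE.
Qed.

(* With [K = k + 1] the first factor vanishes for [t <= a] and the second for
   [t >= b + 1 / K]. The slope [K ^ 2] makes the argument of the second one at
   [t = b] equal to [K], so that the limit at the endpoint [b] is 1. *)
Definition bump1 (a b : R) (k : nat) (t : R) : R :=
  flat 1 (k.+1%:R * t + - (k.+1%:R * a)) *
  flat 1 (- k.+1%:R ^+ 2 * t + (k.+1%:R ^+ 2 * b + k.+1%:R)).

Lemma bump1E a b k t : bump1 a b k t = flat 1 (k.+1%:R * (t - a)) *
  flat 1 (k.+1%:R * (k.+1%:R * (b - t) + 1)).
Proof. by rewrite /bump1; congr (flat _ _ * flat _ _); move: k.+1%:R => K; ring. Qed.

Lemma bump1_ge0 a b k t : 0 <= bump1 a b k t.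
Proof. by rewrite mulr_ge0// flat1_ge0. Qed.

Lemma bump1_le1 a b k t : bump1 a b k t <= 1.
Proof. by rewrite mulr_ile1// ?flat1_ge0 ?flat1_le1. Qed.

Lemma bump1_neq0 a b k t : bump1 a b k t != 0 -> a < t < b + 1.
Proof.
have K0 : 0 < k.+1%:R :> R by rewrite ltr0n.
have K1 : 1 <= k.+1%:R :> R by rewrite ler1n.
rewrite bump1E mulf_eq0 negb_or => /andP[H1 H2]; apply/andP; split.
  rewrite ltNge; apply: contra H1 => ta; rewrite flat_le0//.
  by rewrite mulr_ge0_le0 ?subr_le0// ltW.
rewrite ltNge; apply: contra H2 => bt; rewrite flat_le0//.
rewrite mulr_ge0_le0 ?(ltW K0)//; nra.
Qed.

Lemma cvg_bump1 a b t : bump1 a b k t @[k --> \oo] --> (\1_`]a, b]%classic t : R).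
Proof.
rewrite indicE (_ : bump1 a b ^~ t = fun k => flat 1 (k.+1%:R * (t - a)) *
  flat 1 (k.+1%:R * (k.+1%:R * (b - t) + 1))); last first.
  by apply/funext => k; exact: bump1E.
have [|] := boolP (t \in `]a, b]%classic).
  rewrite inE/= in_itv/= => /andP[ta tb].
  rewrite -[X in _ --> X](mulr1 1); apply: cvgM.
    apply: (@cvg_flat1 _ (t - a)); first by rewrite subr_gt0.
    by move=> k; rewrite mulrC.
  apply: (@cvg_flat1 _ 1) => // k; rewrite mul1r.
  by rewrite mulrDr mulr1 lerDr !mulr_ge0// subr_ge0.
rewrite notin_setE/= in_itv/= => /negP; rewrite negb_and -leNgt -ltNge.
case/orP => [ta|bt].
  rewrite (_ : (fun k => _) = fun=> 0); first exact: cvg_cst.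
  by apply/funext => k; rewrite flat_le0 ?mul0r// mulr_ge0_le0 ?subr_le0.
(* To the right of [b] the second factor is 0 as soon as [(k+1)(t - b) >= 1], whence the
   threshold. *)
apply: cvg_near_cst; exists (Num.trunc (t - b)^-1) => // k /= Hk.
apply/eqP; rewrite [X in _ * X]flat_le0 ?mulr0//.
rewrite mulr_ge0_le0// -opprB mulrN addrC subr_le0 -ler_pdivrMr ?subr_gt0// div1r.
by rewrite (le_trans (ltW (truncnS_gt _)))// ler_nat ltnS.
Qed.

Definition bump (a b : 'I_n -> R) (k : nat) (x : 'rV[R]_n) : R :=
  \prod_(i < n) bump1 (a i) (b i) k (x ord0 i).

Lemma bump_ge0 a b k x : 0 <= bump a b k x.
Proof. by apply: prodr_ge0 => i _; exact: bump1_ge0. Qed.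

Lemma bump_le1 a b k x : bump a b k x <= 1.
Proof. by apply: prodr_ile1 => i _; rewrite bump1_ge0 bump1_le1. Qed.

Lemma bump_neq0 a b : exists M : R, forall k x, bump a b k x != 0 -> `|x| <= M.
Proof.
exists (\sum_i (`|a i| + `|b i| + 1)) => k x /prodf_neq0 xab.
apply: rV_norm_le => [|i]; first by rewrite sumr_ge0.
have /bump1_neq0/andP[ax xb] := xab i isT.
rewrite (bigD1 i)//= ler_wpDr//; first by rewrite sumr_ge0.
have := ler_norm (b i); have := ler_norm (- a i); rewrite normrN.
have := normr_ge0 (b i); have := normr_ge0 (a i).
by rewrite ler_norml => *; apply/andP; split; lra.
Qed.

Lemma test_function_bump a b k : test_function (bump a b k).
Proof.
apply/test_functionP; split.
  apply/smoothP => m; apply: smoothn_prod => i.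
  by apply: smoothnM; exact: smoothn_flat_coord.
by have [M HM] := bump_neq0 a b; exists M => x; exact: HM.
Qed.

Lemma cvg_bump a b (x : 'rV[R]_n) :
  bump a b k x @[k --> \oo] --> (\1_(box a b) x : R).
Proof.
rewrite (_ : \1_(box a b) x = \prod_(i < n) \1_`]a i, b i]%classic (x ord0 i)).
  apply: (@cvg_prod_seq _ _ (fun i k => bump1 (a i) (b i) k (x ord0 i))) => i.
  exact: cvg_bump1.
rewrite indicE; have [|] := boolP (x \in box a b).
  rewrite inE => xab; rewrite big1// => i _.
  by rewrite indicE mem_set//; exact: xab.
rewrite notin_setE => xab; apply/eqP; rewrite eq_sym; apply/eqP/eqP.
rewrite prodf_seq_eq0; apply/hasP.
have /existsNP[i xi] : ~ forall i, x ord0 i \in `]a i, b i] by exact: xab.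
exists i; first by rewrite mem_index_enum.
by rewrite /= indicE memNset.
Qed.

(** Membership in the L2 closure of the test functions. This class is stable under linear
    combinations and L2 limits, and is shown to contain boxes, bounded measurable sets, simple
    functions and finally all of L2. *)
Definition approximable (f : 'rV[R]_n -> R) := forall e : R, 0 < e ->
  exists2 phi, test_function phi & nrm mu (fun x => f x - phi x) < e.

Lemma approximable_test phi : test_function phi -> approximable phi.
Proof.
move=> tphi e e0; exists phi => //.
rewrite (_ : (fun _ => _) = fun=> 0); last by apply/funext => x; rewrite subrr.
by rewrite nrm0.
Qed.

Lemma approximable_cvg (F : nat -> 'rV[R]_n -> R) f :
  (forall k, F k \in Lfun mu 2%:E) -> f \in Lfun mu 2%:E ->
  (forall k, approximable (F k)) ->
  nrm mu (fun x => F k x - f x) @[k --> \oo] --> (0 : R) -> approximable f.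
Proof.
move=> LF Lf aF Ff e e0.
have /cvgr0Pnorm_lt/(_ _ (divr_gt0 e0 (ltr0n _ 2)))[k _ /(_ k (leqnn k))/=] := Ff.
rewrite ger0_norm ?nrm_ge0// => Hk.
have [phi tphi Hphi] := aF k _ (divr_gt0 e0 (ltr0n _ 2)).
exists phi => //.
have Lphi := test_function_sqint tphi.
rewrite (le_lt_trans (ler_nrmB Lf (LF k) Lphi))// [e]splitr ltrD//.
by rewrite nrmBC.
Qed.

Lemma approximableD f g : f \in Lfun mu 2%:E -> g \in Lfun mu 2%:E ->
  approximable f -> approximable g -> approximable (fun x => f x + g x).
Proof.
move=> Lf Lg af ag e e0.
have [phi tphi Hphi] := af _ (divr_gt0 e0 (ltr0n _ 2)).
have [psi tpsi Hpsi] := ag _ (divr_gt0 e0 (ltr0n _ 2)).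
exists (fun x => phi x + psi x); first exact: test_functionD.
have Lphi := test_function_sqint tphi; have Lpsi := test_function_sqint tpsi.
rewrite [e]splitr (le_lt_trans _ (ltrD Hphi Hpsi))//.
rewrite (le_trans _ (nrmD (sqintB Lf Lphi) (sqintB Lg Lpsi)))//.
by rewrite le_eqVlt; apply/orP; left; apply/eqP; congr nrm; apply/funext => x; ring.
Qed.

Lemma approximableZ (c : R) f : f \in Lfun mu 2%:E ->
  approximable f -> approximable (fun x => c * f x).
Proof.
move=> Lf af e e0.
have c0 : 0 < `|c| + 1 by rewrite ltr_wpDl.
have [phi tphi Hphi] := af _ (divr_gt0 e0 c0).
exists (fun x => c * phi x); first exact: test_functionZ.
rewrite (_ : (fun _ => _) = (fun x => c * (f x - phi x))); last first.
  by apply/funext => x; rewrite mulrBr.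
rewrite nrmZ; last by apply: sqintB => //; exact: test_function_sqint.
move: Hphi; rewrite ltr_pdivlMr//.
have := nrm_ge0 mu (fun x => f x - phi x); have := normr_ge0 c; nra.
Qed.

Lemma approximableB f g : f \in Lfun mu 2%:E -> g \in Lfun mu 2%:E ->
  approximable f -> approximable g -> approximable (fun x => f x - g x).
Proof.
move=> Lf Lg af ag; under eq_fun do rewrite -mulN1r.
by apply: approximableD => //; [exact: sqintZ|exact: approximableZ].
Qed.

Lemma approximable_sum (I : Type) (r : seq I) (F : I -> 'rV[R]_n -> R) :
  (forall i, F i \in Lfun mu 2%:E) -> (forall i, approximable (F i)) ->
  approximable (fun x => \sum_(i <- r) F i x).
Proof.
move=> LF aF; elim: r => [|i r IH]; last first.
  under eq_fun do rewrite big_cons; apply: approximableD => //.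
  exact: sqint_sum.
under eq_fun do rewrite big_nil.
apply: approximable_test; apply/test_functionP; split.
  by apply/smoothP => k; exact: smoothn_cst.
by exists 0 => x; rewrite eqxx.
Qed.

(** The bumps converge pointwise to the indicator, and their supports lie in one cube for all [k],
    whose indicator dominates them. *)
Lemma approximable_box a b : approximable \1_(box a b).
Proof.
have [M HM] := bump_neq0 a b; have [m Hm] := @norm_le_cube R n M.
have [||||Lab cab] := @dominated_nrm _ _ _ mu (bump a b) \1_(box a b)
  (\1_(cube m) : 'rV[R]_n -> R).
- exact: sqint_indic_cube.
- by move=> k; apply: test_function_measurable; exact: test_function_bump.
- exact: cvg_bump.
- move=> k x; have [->|/HM/Hm xm] := eqVneq (bump a b k x) 0.
    by rewrite normr0.
  by rewrite ger0_norm ?bump_ge0// indicE mem_set// bump_le1.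
- apply: approximable_cvg cab => // k.
    by apply: test_function_sqint; exact: test_function_bump.
  by apply: approximable_test; exact: test_function_bump.
Qed.

Lemma sqint_indicI_cube (A : set 'rV[R]_n) m : measurable A ->
  (\1_(A `&` cube m) : 'rV[R]_n -> R) \in Lfun mu 2%:E.
Proof.
move=> mA; have mAc : measurable (A `&` cube m).
  by apply: measurableI => //; exact: measurable_box.
apply: sqint_indic => //.
apply: (le_lt_trans _ (lebesgue_box_lty (fun=> - m%:R) (fun=> m%:R))).
by apply: le_measure; rewrite ?inE//; exact: measurable_box.
Qed.

(** Dynkin's pi-lambda argument. Truncation to a cube keeps all measures finite, so that the
    complement becomes a difference of two square integrable indicators. *)
Lemma approximable_set m (A : set 'rV[R]_n) : measurable A ->
  approximable \1_(A `&` cube m).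
Proof.
move=> mA; move: (mA); rewrite measurable_rV_boxes; move: A mA => A _.
move: A; apply: (dynkin_induction (P := fun A => approximable \1_(A `&` cube m))
  measurable_rV_boxes boxes_setI).
- by rewrite setTI; exact: approximable_box.
- move=> A GA; have [[a b] _ <-] : boxes (A `&` cube m).
    by apply: boxes_setI => //; eexists (_, _).
  exact: approximable_box.
- move=> A mA aA.
  rewrite (_ : \1_(_) = (fun x : 'rV[R]_n => \1_(cube m) x - \1_(A `&` cube m) x)).
    apply: approximableB => //; [exact: sqint_indic_cube|
      exact: sqint_indicI_cube|exact: approximable_box].
  apply/funext => x; rewrite !indicE !in_setI in_setC.
  by case: (x \in A); case: (x \in cube m); rewrite /= ?subr0 ?subrr.
- move=> F mF tF aF.
  (* By disjointness the partial sums are themselves indicators, hence dominated by that of the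
     cube. *)
  pose S N x : R := \sum_(0 <= i < N) \1_(F i `&` cube m) x.
  have SE N x : S N x = \1_(\bigcup_(i < N) F i `&` cube m) x.
    rewrite /S; have [xF|xF] := pselect (exists2 i, (i < N)%N & (F i `&` cube m) x).
      move: xF => [i iN Fix]; rewrite [RHS]indicE mem_set; last first.
        by case: Fix => Fix cx; split => //; exists i.
      rewrite big_mkord (bigD1 (Ordinal iN))//= indicE mem_set//= big1 ?addr0// => j ji.
      rewrite indicE memNset// => -[Fjx _]; case/eqP: ji; apply/val_inj => /=.
      by apply: (tF j i) => //; exists x; split => //; case: Fix.
    rewrite [RHS]indicE memNset; last first.
      by move=> [[i iN Fix] cx]; apply: xF; exists i.
    rewrite big_nat big1// => i /andP[_ iN]; rewrite indicE memNset// => Fix.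
    by apply: xF; exists i.
  have aS N : approximable (S N).
    by apply: approximable_sum => i //; exact: sqint_indicI_cube.
  have [||||LF cF] := @dominated_nrm _ _ _ mu S \1_(\bigcup_i F i `&` cube m)
    (\1_(cube m) : 'rV[R]_n -> R).
  + exact: sqint_indic_cube.
  + by move=> N; apply: measurable_sum => i; apply: sqint_measurable;
      exact: sqint_indicI_cube.
  + move=> x; have [xF|xF] := pselect ((\bigcup_i F i `&` cube m) x).
      rewrite indicE mem_set//; apply: cvg_near_cst.
      case: xF => -[i _ Fix] cx; exists i.+1 => // N /= iN.
      by apply/eqP; rewrite SE indicE mem_set//; split => //; exists i.
    rewrite indicE memNset//; apply: cvg_near_cst; apply: nearW => N.
    apply/eqP; rewrite SE indicE memNset// => -[[i _ Fix] cx].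
    by apply: xF; split => //; exists i.
  + move=> N x; rewrite SE ger0_norm// !indicE ler_nat.
    by rewrite in_setI; case: (x \in cube m); rewrite ?andbF// leq_b1.
  + apply: approximable_cvg cF => // N.
    by apply: sqint_sum => i _; exact: sqint_indicI_cube.
Qed.

Import HBNNSimple.

(** Simple functions increasing to [f] are cut off to growing cubes, which gives their level sets
    finite measure; [f] itself dominates them. *)
Lemma approximable_nonneg f : (forall x, 0 <= f x) -> f \in Lfun mu 2%:E ->
  approximable f.
Proof.
move=> f0 Lf.
have mf : measurable_fun [set: 'rV[R]_n] (EFin \o f).
  by apply/measurable_EFinP; exact: (sqint_measurable Lf).
pose s k := nnsfun_approx measurableT mf k.
pose F k x : R := s k x * \1_(cube k) x.
have sf k x : s k x <= f x.
  by rewrite -lee_fin /s nnsfun_approxE; apply: le_approx => // y _; rewrite lee_fin.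
have [|||_ cF] := @dominated_nrm _ _ _ mu F f f Lf.
- move=> k; apply: measurable_funM => //; apply: measurable_indic.
  exact: measurable_box.
- move=> x; rewrite -[X in _ --> X]mulr1; apply: cvgM.
    have : EFin \o s ^~ x @ \oo --> (f x)%:E.
      by apply: (cvg_nnsfun_approx measurableT mf) => // y _; rewrite lee_fin.
    by move=> /fine_cvgP[].
  have [k xk] := cube_exists x; apply: cvg_near_cst; exists k => // m /= km.
  by apply/eqP; rewrite indicE mem_set//; exact: xk.
- move=> k x; rewrite ger0_norm ?mulr_ge0// (le_trans _ (sf k x))//.
  by rewrite ler_piMr// indicE lern1 leq_b1.
have FE k : F k = fun x => \sum_(y <- finmap.enum_fset (fset_set (range (s k))))
    y * \1_(s k @^-1` [set y] `&` cube k) x.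
  apply/funext => x; rewrite /F fimfunE fsbig_finite//= mulr_suml.
  by apply: eq_bigr => y _; rewrite indicI mulrA.
have mS k y : measurable (s k @^-1` [set y]) by [].
apply: approximable_cvg cF => // k; rewrite FE.
  by apply: sqint_sum => y _; apply: sqintZ; exact: sqint_indicI_cube.
apply: approximable_sum => y; first by apply: sqintZ; exact: sqint_indicI_cube.
by apply: approximableZ; [exact: sqint_indicI_cube|exact: approximable_set].
Qed.

Lemma test_function_dense f : f \in Lfun mu 2%:E -> approximable f.
Proof.
move=> Lf; have mf := sqint_measurable Lf.
pose p x := Num.max (f x) 0; pose q x := Num.max (- f x) 0.
have Lp : p \in Lfun mu 2%:E.
  apply: (sqint_bound _ Lf) => [|x]; first exact: measurable_maxr.
  by rewrite /p; case: (leP (f x) 0); rewrite ?normr0.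
have Lq : q \in Lfun mu 2%:E.
  apply: (sqint_bound _ Lf) => [|x].
    by apply: measurable_maxr => //; exact: measurableT_comp.
  by rewrite /q; case: (leP (- f x) 0); rewrite ?normr0// normrN.
rewrite (_ : f = fun x => p x - q x).
  by apply: approximableB => //; apply: approximable_nonneg => // x;
    rewrite /p /q le_max lexx orbT.
by apply/funext => x; rewrite /p /q; case: (leP (f x) 0); case: (leP (- f x) 0); lra.
Qed.

End bumps.

(** * Weak derivatives *)

Section weak_derivatives.
Context {R : realType} {n : nat}.
Implicit Types (f g v w phi : 'rV[R]_n -> R).
Local Notation mu := (lebesgue_rV n : {measure set 'rV[R]_n -> \bar R}).
Local Notation e_ i := (delta_mx ord0 i : 'rV[R]_n).

Lemma measurable_translate f (a : 'rV[R]_n) : measurable_fun [set: 'rV[R]_n] f ->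
  measurable_fun [set: 'rV[R]_n] (fun x => f (x + a)).
Proof. by move=> mf; apply: (measurableT_comp mf); exact: measurable_shift. Qed.

Lemma sqint_translate f (a : 'rV[R]_n) : f \in Lfun mu 2%:E ->
  (fun x => f (x + a)) \in Lfun mu 2%:E.
Proof.
move=> Lf; have mf := sqint_measurable Lf; apply: sqintP.
  exact: measurable_translate.
rewrite (@integral_shift _ _ a (fun x => ((f x) ^+ 2)%:E)).
  by rewrite sqintE// ltry.
by apply/measurable_EFinP; exact: measurable_funX.
Qed.

Lemma ip_translate f g (a : 'rV[R]_n) : f \in Lfun mu 2%:E -> g \in Lfun mu 2%:E ->
  ip mu (fun x => f (x + a)) g = ip mu f (fun x => g (x - a)).
Proof.
move=> Lf Lg; congr fine.
rewrite -[RHS](@integral_shift _ _ a (fun x => (f x * g (x - a))%:E)).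
  by apply: eq_integral => x _; rewrite addrK.
apply/measurable_EFinP; apply: measurable_funM; first exact: (sqint_measurable Lf).
by apply: measurable_translate; exact: (sqint_measurable Lg).
Qed.

Lemma nrm_translate f (a : 'rV[R]_n) : f \in Lfun mu 2%:E ->
  nrm mu (fun x => f (x + a)) = nrm mu f.
Proof.
move=> Lf; apply/eqP; rewrite -(eqrXn2 (ltn0Sn 1)) ?nrm_ge0//.
rewrite !nrm_sqr ?sqint_translate// ip_translate ?sqint_translate//.
by apply/eqP; congr ip; apply/funext => x; rewrite subrK.
Qed.

Lemma is_derive_translate_line f (x a : 'rV[R]_n) (t : R) :
  derivable f (x + t *: a) a ->
  is_derive t 1 (fun s => f (x + s *: a)) ('D_a f (x + t *: a)).
Proof.
move=> df.
have E : (fun h : R => h^-1 *: (((fun s => f (x + s *: a)) \o shift t) (h *: 1) -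
    f (x + t *: a))) =
  (fun h => h^-1 *: ((f \o shift (x + t *: a)) (h *: a) - f (x + t *: a))).
  by apply/funext => h /=; rewrite [h *: 1]mulr1 scalerDl addrCA.
by apply: DeriveDef; rewrite /derivable /derive E.
Qed.

(** Differentiation under the integral sign for [|t| < 1], dominated by [|v|] times a multiple of
    the indicator of a cube. *)
Lemma is_derive_ip_translate0 v phi i : v \in Lfun mu 2%:E -> test_function phi ->
  is_derive (0 : R) 1 (fun h : R => ip mu v (fun x => phi (x + h *: e_ i)))
    (ip mu v (pderiv i phi)).
Proof.
move=> Lv tphi; have sphi := test_function_smooth tphi.
have [M [B [B0 HB HM]]] := test_function_bounded (test_function_pderiv i tphi).
(* The [+ 1] makes room for all translates with [|t| < 1], as [e_ i] has norm at most 1. *)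
have [k Hk] := @norm_le_cube R n (M + 1).
pose F (t : R) x := v x * phi (x + t *: e_ i).
have dF (t : R) x : is_derive t 1 (F ^~ x) (v x * pderiv i phi (x + t *: e_ i)).
  have H := is_derive_translate_line (@smooth_derivable _ _ phi i (x + t *: e_ i) sphi).
  exact: (is_deriveZ (v x) H).
have I0 : `](-1 : R), 1[%classic 0 by rewrite /= in_itv/= ltrN10 ltr01.
pose G x := `|v x| * (B * \1_(cube k) x).
have intF t : `](-1 : R), 1[%classic t -> mu.-integrable setT (EFin \o F t).
  move=> _; apply: (sqint_mul Lv); apply: test_function_sqint.
  exact: test_function_translate.
have drF t x : `](-1 : R), 1[%classic t -> setT x -> derivable (F ^~ x) t 1.
  by move=> _ _; have [] := dF t x.
have G0 x : 0 <= G x by rewrite !mulr_ge0.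
have intG : mu.-integrable setT (EFin \o G).
  apply: sqint_mul; last by apply: sqintZ; exact: sqint_indic_cube.
  apply: (sqint_bound _ Lv) => [|x]; last by rewrite normr_id.
  by apply: measurableT_comp => //; exact: (sqint_measurable Lv).
have GF t x : `](-1 : R), 1[%classic t -> setT x -> `|partial1of2 F t x| <= G x.
  rewrite /= in_itv/= => /andP[t1 t2] _; rewrite partial1of2E.
  have [_ ->] := dF t x; rewrite normrM ler_wpM2l//.
  have [xM|/HM ->] := leP `|x + t *: e_ i| M; last by rewrite normr0 mulr_ge0.
  rewrite indicE mem_set ?mulr1//; apply: Hk.
  rewrite -[x](addrK (t *: e_ i)) (le_trans (ler_normB _ _))// lerD//.
  rewrite normrZ mulr_ile1 ?norm_delta_mx//.
  by rewrite ler_norml; apply/andP; split; apply: ltW.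
have d1 := derivable_under_integral measurableT I0 intF drF G0 intG GF.
have d2 := differentiation_under_integral measurableT I0 intF drF G0 intG GF.
apply: DeriveDef => //; rewrite -derive1E d2.
apply: eq_Rintegral => x _; rewrite partial1of2E.
by have [_ ->] := dF 0 x; rewrite scale0r addr0.
Qed.

(** A relation between two arbitrary functions, so that it can also link [weak_pderivs [:: i] w] to
    [weak_pderivs [:: i; i] w]. *)
Definition weak_pderiv i v g := forall phi, test_function phi ->
  ip mu v (pderiv i phi) = - ip mu g phi.

(** Replacing [phi] by its translate, again a test function, moves [t] to the origin. *)
Lemma is_derive_ip_translate v g phi i (t : R) : v \in Lfun mu 2%:E ->
  weak_pderiv i v g -> test_function phi ->
  is_derive t 1 (fun h : R => ip mu v (fun x => phi (x + h *: e_ i)))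
    (- ip mu g (fun x => phi (x + t *: e_ i))).
Proof.
move=> Lv vg tphi.
have tpsi := test_function_translate (t *: e_ i) tphi.
have := is_derive_ip_translate0 i Lv tpsi; rewrite vg//.
set F := fun h : R => _; set H := fun h : R => _.
have FH h : F h = H (t + h).
  by congr ip; apply/funext => x; rewrite scalerDl (addrC (t *: _)) addrA.
have E : (fun h : R => h^-1 *: ((F \o shift 0) (h *: 1) - F 0)) =
    (fun h : R => h^-1 *: ((H \o shift t) (h *: 1) - H t)).
  by apply/funext => h /=; rewrite !FH !addr0 (addrC t).
by case=> dF dFE; apply: DeriveDef; rewrite /derivable /derive -E.
Qed.

Lemma mean_value_le (F dF : R -> R) (K h : R) :
  (forall t : R, is_derive t 1 F (dF t)) -> (forall t, `|dF t| <= K) ->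
  `|F h - F 0| <= K * `|h|.
Proof.
move=> HF HK.
have cF : continuous F.
  by move=> t; apply/differentiable_continuous/derivable1_diffP; have [] := HF t.
have [h0|h0] := leP 0 h.
  have [c _ ->] := MVT_segment h0 (fun t _ => HF t) (continuous_subspaceT cF).
  by rewrite subr0 normrM ler_wpM2r.
have [c _ E] := MVT_segment (ltW h0) (fun t _ => HF t) (continuous_subspaceT cF).
by rewrite distrC E sub0r normrM normrN ler_wpM2r.
Qed.

(** The quotient is taken backward, so that translation invariance turns it into a forward increment
    of the other factor. *)
Definition diff_quot i (h : R) v := fun x => h^-1 * (v x - v (x - h *: e_ i)).

Lemma sqint_diff_quot i h v : v \in Lfun mu 2%:E ->
  diff_quot i h v \in Lfun mu 2%:E.
Proof. by move=> Lv; apply/sqintZ/sqintB => //; exact: sqint_translate. Qed.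

Lemma ip_diff_quot i h v w : v \in Lfun mu 2%:E -> w \in Lfun mu 2%:E ->
  ip mu (diff_quot i h v) w = - (h^-1 * (ip mu v (fun x => w (x + h *: e_ i)) - ip mu v w)).
Proof.
move=> Lv Lw; have Ltv := sqint_translate (- (h *: e_ i)) Lv.
rewrite /diff_quot ipZl//; last exact: sqintB.
rewrite ipBl// (@ip_translate v w)// -mulrN opprB; congr (_ * (_ - ip mu v _)).
by apply/funext => x; rewrite opprK.
Qed.

(** Discrete integration by parts: the adjoint of the backward quotient is minus the forward one,
    which is the quotient of step [- h]. *)
Lemma ip_diff_quotC i h v w : v \in Lfun mu 2%:E -> w \in Lfun mu 2%:E ->
  ip mu (diff_quot i h v) w = - ip mu v (diff_quot i (- h) w).
Proof.
move=> Lv Lw; rewrite ip_diff_quot// [in RHS]ipC ip_diff_quot//.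
rewrite (ipC _ w (fun x => v _)) (@ip_translate v w)// (ipC _ w v) invrN mulNr.
by congr (- _); rewrite opprK; congr (_ * (ip mu v _ - _)); apply/funext => x;
  rewrite scaleNr opprK.
Qed.

Lemma nrm_le_dual f (K : R) : 0 <= K -> f \in Lfun mu 2%:E ->
  (forall phi, test_function phi -> `|ip mu f phi| <= K * nrm mu phi) ->
  nrm mu f <= K.
Proof.
move=> K0 Lf H; rewrite leNgt; apply/negP => KN.
set N := nrm mu f in KN.
have N0 : 0 < N by rewrite (le_lt_trans K0).
(* With [d] the distance from [f] to [phi], the bounds below give [N^2 <= K (N + d) + N d], that is
   [(N - K) N <= d (K + N)]. This accuracy excludes it. *)
have e0 : 0 < (N - K) * N / (2 * (K + N)).
  by rewrite divr_gt0// mulr_gt0 ?subr_gt0// ltr_wpDl.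
have [phi tphi Hphi] := test_function_dense Lf e0.
have Lphi := test_function_sqint tphi; have Lfphi := sqintB Lf Lphi.
set d := nrm mu _ in Hphi.
have d0 : 0 <= d := nrm_ge0 _ _.
have {}Hphi : d * (2 * (K + N)) < (N - K) * N.
  by rewrite -ltr_pdivlMr// mulr_gt0// ltr_wpDl.
have E : N ^+ 2 = ip mu f phi + ip mu f (fun x => f x - phi x).
  by rewrite nrm_sqr// ipBr// addrC subrK.
have H1 : ip mu f phi <= K * (N + d).
  rewrite (le_trans (ler_norm _))// (le_trans (H _ tphi))// ler_wpM2l//.
  have := nrmD Lf (sqintN Lfphi); rewrite nrmN// => /(le_trans _); apply.
  by rewrite le_eqVlt; apply/orP; left; apply/eqP; congr nrm; apply/funext => x; ring.
have H2 : ip mu f (fun x => f x - phi x) <= N * d.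
  by rewrite (le_trans (ler_norm _))//; exact: cauchy_schwarz.
nra.
Qed.

(** Tested against [phi], the quotient is up to sign an increment, divided by [h], of a function of
    the translation parameter. Translations being isometric, the derivative of that function is at
    most [nrm mu g * nrm mu phi], and duality removes [phi]. *)
Lemma nrm_diff_quot i h v g : h != 0 -> v \in Lfun mu 2%:E -> g \in Lfun mu 2%:E ->
  weak_pderiv i v g -> nrm mu (diff_quot i h v) <= nrm mu g.
Proof.
move=> h0 Lv Lg vg; apply: nrm_le_dual => [||phi tphi]; first exact: nrm_ge0.
  exact: sqint_diff_quot.
have Lphi := test_function_sqint tphi.
rewrite ip_diff_quot// normrN normrM normfV ler_pdivrMl ?normr_gt0//.
have := @mean_value_le _ _ (nrm mu g * nrm mu phi) h
  (fun t => is_derive_ip_translate t Lv vg tphi).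
rewrite (_ : (fun x => phi (x + 0 *: e_ i)) = phi); last first.
  by apply/funext => x; rewrite scale0r addr0.
rewrite (mulrC `|h|); apply => t; rewrite normrN.
rewrite -(nrm_translate (t *: e_ i) Lphi) cauchy_schwarz//.
exact: sqint_translate.
Qed.

Lemma cvg_diff_quot i (u : nat -> R) v g w : v \in Lfun mu 2%:E ->
  g \in Lfun mu 2%:E -> w \in Lfun mu 2%:E -> weak_pderiv i v g ->
  (forall k, u k != 0) -> u @ \oo --> (0 : R) ->
  ip mu (diff_quot i (u k) v) w @[k --> \oo] --> ip mu g w.
Proof.
move=> Lv Lg Lw vg u0 ucvg; apply/cvgrPdist_lt => e e0.
pose N := nrm mu g; have N0 : 0 <= N := nrm_ge0 _ _.
(* Replacing [w] by [phi] costs at most [N d] for [g] and, uniformly in [k], [N d] for the quotient.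
   The [+ 1] covers [N = 0]. *)
have d0 : 0 < e / (2 * N + 1) by rewrite divr_gt0// ltr_wpDl// mulr_ge0.
have [phi tphi Hphi] := test_function_dense Lw d0.
have Lphi := test_function_sqint tphi; have Lwphi := sqintB Lw Lphi.
set d := nrm mu _ in Hphi; have dn0 : 0 <= d := nrm_ge0 _ _.
rewrite ltr_pdivlMr ?ltr_wpDl ?mulr_ge0// in Hphi.
have H : ip mu (diff_quot i (u k) v) phi @[k --> \oo] --> ip mu g phi.
  have [dF EF] := is_derive_ip_translate 0 Lv vg tphi.
  rewrite -[X in _ --> X]opprK; under eq_fun do rewrite ip_diff_quot//.
  apply: cvgN; move: dF; rewrite /derivable; move: EF; rewrite /derive => EF.
  move=> /cvg_ex[/= l Hl]; have El := cvg_lim (@Rhausdorff R) Hl.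
  have {EF}El : l = - ip mu g phi.
    rewrite -El EF; congr (- ip mu g _); apply/funext => x.
    by rewrite scale0r addr0.
  rewrite -El; move/cvgr_dnbhsP : Hl => /(_ u (conj u0 ucvg)).
  rewrite (_ : (fun k => _) = (fun k => (u k)^-1 *
    (ip mu v (fun x => phi (x + u k *: e_ i)) - ip mu v phi)))//.
  apply/funext => k /=; rewrite addr0 [u k *: 1]mulr1 scale0r.
  by congr (_ * (_ - ip mu v _)); apply/funext => x; rewrite addr0.
have e1 : 0 < e - d * (2 * N) by lra.
move/cvgrPdist_lt : H => /(_ _ e1); apply: filterS => k Hk.
have LD := sqint_diff_quot i (u k) Lv.
have E : ip mu g w - ip mu (diff_quot i (u k) v) w =
  (ip mu g phi - ip mu (diff_quot i (u k) v) phi) +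
  (ip mu g (fun x => w x - phi x) - ip mu (diff_quot i (u k) v) (fun x => w x - phi x)).
  by rewrite !ipBr//; ring.
rewrite E (le_lt_trans (ler_normD _ _))//.
have H1 := cauchy_schwarz Lg Lwphi.
have H2 := cauchy_schwarz LD Lwphi.
have H3 := nrm_diff_quot (u0 k) Lv Lg vg.
have H4 := ler_normB (ip mu g (fun x => w x - phi x))
  (ip mu (diff_quot i (u k) v) (fun x => w x - phi x)).
rewrite -/d -/N in H1 H2 H3.
nra.
Qed.

Lemma weak_ibp i v g w k : v \in Lfun mu 2%:E -> g \in Lfun mu 2%:E ->
  w \in Lfun mu 2%:E -> k \in Lfun mu 2%:E ->
  weak_pderiv i v g -> weak_pderiv i w k -> ip mu g w = - ip mu v k.
Proof.
move=> Lv Lg Lw Lk vg wk; pose u m : R := m.+1%:R^-1.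
have u0 m : u m != 0 by rewrite invr_eq0 pnatr_eq0.
have ucvg : u @ \oo --> (0 : R) by exact: cvg_harmonic.
have H1 := cvg_diff_quot Lv Lg Lw vg u0 ucvg.
(* [ip_diff_quotC] moves the step [u m] on [v] to the step [- u m] on [w], so one sequence has both
   sides of the claim as limits. *)
have Nu0 m : - u m != 0 by rewrite oppr_eq0.
have Nucvg : - u m @[m --> \oo] --> (0 : R) by rewrite -oppr0; exact: cvgN.
have H2 := cvg_diff_quot Lw Lk Lv wk Nu0 Nucvg.
have {}H2 : ip mu (diff_quot i (u m) v) w @[m --> \oo] --> - ip mu v k.
  rewrite ipC; under eq_fun do rewrite ip_diff_quotC// ipC.
  exact: cvgN.
exact: (cvg_unique (@Rhausdorff R) H1 H2).
Qed.

(** [xget] returns its default 0 only if no weak derivative exists, which membership in [H2] rules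
    out up to order 2. *)
Lemma weak_pderivsP s w : H2 w -> (size s <= 2)%N ->
  weak_pderivs s w \in Lfun mu 2%:E /\ is_weak_pderivs s w (weak_pderivs s w).
Proof.
move=> [_ /(_ s)] H /H[g Lg wg].
by have [] := @xgetPex _ (fun=> 0)
  [set g | L2 g /\ is_weak_pderivs s w g] (ex_intro _ g (conj Lg wg)).
Qed.

Lemma weak_pderiv1 i w : H2 w -> weak_pderiv i w (weak_pderivs [:: i] w).
Proof.
move=> Hw phi tphi; have [_ /(_ _ tphi)] := @weak_pderivsP [:: i] w Hw isT.
by rewrite /= expr1 mulN1r.
Qed.

(** The integral of [w] against the second derivative of [phi] is computed in two ways: directly,
    and as a first derivative tested against [pderiv i phi]. *)
Lemma weak_pderiv2 i w : H2 w ->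
  weak_pderiv i (weak_pderivs [:: i] w) (weak_pderivs [:: i; i] w).
Proof.
move=> Hw phi tphi; have [_ /(_ _ tphi)] := @weak_pderivsP [:: i; i] w Hw isT.
rewrite /= sqrrN expr1n mul1r -/(ip _ _ _) -/(ip _ _ _) => <-.
by rewrite (weak_pderiv1 i Hw (test_function_pderiv i tphi)) opprK.
Qed.

Lemma sqint_weak_laplacian w : H2 w -> weak_laplacian w \in Lfun mu 2%:E.
Proof.
by move=> Hw; apply: sqint_sum => i _; have [] := @weak_pderivsP [:: i; i] w Hw isT.
Qed.

Lemma green v w : H2 v -> H2 w ->
  ip mu (weak_laplacian v) w =
  - \sum_(i < n) ip mu (weak_pderivs [:: i] v) (weak_pderivs [:: i] w).
Proof.
move=> Hv Hw; have [Lw _] := Hw.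
rewrite /weak_laplacian ip_suml//; last first.
  by move=> i _; have [] := @weak_pderivsP [:: i; i] v Hv isT.
rewrite -sumrN; apply: eq_bigr => i _.
have [Lvi _] := @weak_pderivsP [:: i] v Hv isT.
have [Lvii _] := @weak_pderivsP [:: i; i] v Hv isT.
have [Lwi _] := @weak_pderivsP [:: i] w Hw isT.
exact: (weak_ibp Lvi Lvii Lw Lwi (weak_pderiv2 i Hv) (weak_pderiv1 i Hw)).
Qed.

Lemma weak_laplacian_sym v w : H2 v -> H2 w ->
  ip mu (weak_laplacian v) w = ip mu v (weak_laplacian w).
Proof.
move=> Hv Hw; apply: (eq_trans (green Hv Hw)); apply: esym.
apply: (eq_trans (ipC mu v _)); apply: (eq_trans (green Hw Hv)).
by apply: (congr1 -%R); apply: eq_bigr => i _; exact: ipC.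
Qed.

Lemma weak_laplacian_le0 w : H2 w -> ip mu (weak_laplacian w) w <= 0.
Proof.
by move=> Hw; rewrite (green Hw Hw) oppr_le0 sumr_ge0// => i _; exact: ip_ge0.
Qed.

End weak_derivatives.

(** * The heat equation with a potential *)

Section L2_paths.
Context d (T : measurableType d) (R : realType).
Variable mu : {measure set T -> \bar R}.
Local Notation sqint f := (f \in Lfun mu 2%:E).

(** The error splits into [(a - a0, b - b0) + (a - a0, b0) + (a0, b - b0)]. The filter is left
    general to serve both punctured neighbourhoods and limits within an interval. *)
Lemma cvg_ip (I : Type) (F : set_system I) (FF : Filter F)
    (a b : I -> T -> R) (a0 b0 : T -> R) :
  (\forall r \near F, sqint (a r)) -> (\forall r \near F, sqint (b r)) ->
  sqint a0 -> sqint b0 ->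
  nrm mu (fun x => a r x - a0 x) @[r --> F] --> (0 : R) ->
  nrm mu (fun x => b r x - b0 x) @[r --> F] --> (0 : R) ->
  ip mu (a r) (b r) @[r --> F] --> ip mu a0 b0.
Proof.
move=> La Lb La0 Lb0 Ha Hb; apply: cvg_zero.
pose da r := nrm mu (fun x => a r x - a0 x).
pose db r := nrm mu (fun x => b r x - b0 x).
have H : da r * db r + da r * nrm mu b0 + nrm mu a0 * db r @[r --> F] --> (0 : R).
  have -> : 0 = 0 * 0 + 0 * nrm mu b0 + nrm mu a0 * 0 :> R by ring.
  apply: cvgD; [apply: cvgD|].
  - exact: (cvgM Ha Hb).
  - by apply: cvgM Ha _; exact: cvg_cst.
  - by apply: cvgM _ Hb; exact: cvg_cst.
apply/cvgr0Pnorm_le => e e0.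
move/cvgr0Pnorm_le : H => /(_ e e0) H.
near=> r.
have Lar : sqint (a r) by near: r.
have Lbr : sqint (b r) by near: r.
have Hr : da r * db r + da r * nrm mu b0 + nrm mu a0 * db r <= e.
  by rewrite (le_trans (ler_norm _))//; near: r.
apply: (le_trans _ Hr); rewrite !fctE.
have La' := sqintB Lar La0; have Lb' := sqintB Lbr Lb0.
rewrite (_ : _ - _ = ip mu (fun x => a r x - a0 x) (fun x => b r x - b0 x) +
  ip mu (fun x => a r x - a0 x) b0 + ip mu a0 (fun x => b r x - b0 x)); last first.
  by rewrite (ipBr Lbr Lb0 La')// !ipBl// ipBr//; ring.
rewrite (le_trans (ler_normD _ _))// lerD ?cauchy_schwarz//.
by rewrite (le_trans (ler_normD _ _))// lerD ?cauchy_schwarz.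
Unshelve. all: by end_near. Qed.

Lemma is_derive_ip (a b : R -> T -> R) (a' b' : T -> R) (t : R) :
  (\forall r \near t, sqint (a r)) -> (\forall r \near t, sqint (b r)) ->
  sqint a' -> sqint b' ->
  nrm mu (fun x => h^-1 * (a (t + h) x - a t x) - a' x) @[h --> 0^'] --> (0 : R) ->
  nrm mu (fun x => h^-1 * (b (t + h) x - b t x) - b' x) @[h --> 0^'] --> (0 : R) ->
  is_derive t 1 (fun s => ip mu (a s) (b s)) (ip mu a' (b t) + ip mu (a t) b').
Proof.
move=> La Lb La' Lb' Ha Hb.
have Lat := nbhs_singleton La; have Lbt := nbhs_singleton Lb.
pose Da h x := h^-1 * (a (t + h) x - a t x).
pose Db h x := h^-1 * (b (t + h) x - b t x).
have nearD (f : R -> T -> R) : (\forall r \near t, sqint (f r)) ->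
    \forall h \near 0^', sqint (f (t + h)).
  move=> Lf; apply: cvg_within; rewrite near_simpl.
  have H : t + h @[h --> (0 : R)] --> t.
    rewrite -[X in _ --> X]addr0.
    by apply: (@continuousD _ _ _ (cst t) idfun (0 : R)); [exact: cst_continuous|move=> A].
  exact: (H _ Lf).
have LDa : \forall h \near 0^', sqint (Da h).
  by apply: filterS (nearD _ La) => h Lh; apply/sqintZ/sqintB.
have LDb : \forall h \near 0^', sqint (Db h).
  by apply: filterS (nearD _ Lb) => h Lh; apply/sqintZ/sqintB.
have c0 (c : T -> R) : nrm mu (fun x => c x - c x) @[_ --> (0 : R)^'] --> (0 : R).
  rewrite (_ : (fun _ => _) = (fun=> 0)); first exact: cvg_cst.
  by apply/funext => h; under eq_fun do rewrite subrr; exact: nrm0.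
have H1 : ip mu (Da h) (b t) @[h --> 0^'] --> ip mu a' (b t).
  by apply: (@cvg_ip _ _ _ Da (fun=> b t)) => //; exact: nearW.
have H2 : ip mu (a t) (Db h) @[h --> 0^'] --> ip mu (a t) b'.
  by apply: (@cvg_ip _ _ _ (fun=> a t) Db) => //; exact: nearW.
have H3 : ip mu (Da h) (Db h) @[h --> 0^'] --> ip mu a' b' by exact: cvg_ip.
have id0 : (h : R) @[h --> 0^'] --> (0 : R) by apply: cvg_within.
have H : h^-1 *: (((fun s => ip mu (a s) (b s)) \o shift t) (h *: 1) -
    ip mu (a t) (b t)) @[h --> 0^'] --> ip mu a' (b t) + ip mu (a t) b'.
  (* The difference quotient equals [(Da h, b t) + (a t, Db h) + h (Da h, Db h)]; the added zero is
     the limit of the last term. *)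
  have -> : ip mu a' (b t) + ip mu (a t) b' =
      ip mu a' (b t) + ip mu (a t) b' + 0 * ip mu a' b' by rewrite mul0r addr0.
  apply: cvg_trans (cvgD (cvgD H1 H2) (cvgM id0 H3)); apply: near_eq_cvg.
  near=> h.
  have h0 : h != 0 by near: h; exact: nbhs_dnbhs_neq.
  have Lah : sqint (a (t + h)) by near: h; exact: nearD.
  have Lbh : sqint (b (t + h)) by near: h; exact: nearD.
  rewrite /= [h *: 1]mulr1 (addrC h t) /Da /Db.
  have LBa := sqintB Lah Lat; have LBb := sqintB Lbh Lbt.
  rewrite !fctE/= !ipZl//; last exact: sqintZ.
  rewrite !(ipC _ _ (fun x => _ * _)) !ipZl//.
  rewrite (ipBl Lah Lat Lbt) (ipBl Lbh Lbt Lat) (ipBl Lbh Lbt LBa).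
  rewrite !(ipC _ _ (fun x => _ - _)) (ipBl Lah Lat Lbh) (ipBl Lah Lat Lbt).
  rewrite (ipC _ (b (t + h)) (a t)) (ipC _ (b t) (a t)) /GRing.scale/=.
  by field.
by apply: DeriveDef; [apply/cvg_ex; eexists; exact: H|exact: cvg_lim H].
Unshelve. all: by end_near. Qed.

End L2_paths.

Section filters.
Context {R : realType}.

Lemma cvg_within_map (f : R -> R) (A B : set R) (s : R) :
  {for s, continuous f} -> (forall r, A r -> B (f r)) ->
  f @ within A (nbhs s) --> within B (nbhs (f s)).
Proof.
move=> cf AB S HS; apply: (@filterS _ (nbhs s) _ _ _ _ (cf _ HS)) => r Hr Ar.
by apply: Hr; exact: AB.
Qed.

Lemma cvg_dnbhs0N (f : R -> R) (l : R) :
  f h @[h --> 0^'] --> l -> f (- h) @[h --> 0^'] --> l.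
Proof.
move=> /cvgr_dnbhsP H; apply/cvgr_dnbhsP => u [u0 ucvg].
apply: (H (fun k => - u k)); split; first by move=> k; rewrite oppr_eq0.
by rewrite -oppr0; exact: cvgN.
Qed.

End filters.

(** * Energy estimates for solutions *)

Section heat.
Context {R : realType} {n : nat}.
Variable V : 'rV[R]_n -> R.
Hypothesis Vbound : [bounded V x | x in [set: 'rV[R]_n]].
Hypothesis Vcont : continuous V.
Hypothesis Vpos : forall x, 0 < V x.
Local Notation mu := (lebesgue_rV n : {measure set 'rV[R]_n -> \bar R}).

Let mV : measurable_fun [set: 'rV[R]_n] V.
Proof. exact: continuous_measurable_rV. Qed.

Let V_le : exists M, forall x, `|V x| <= M.
Proof.
have [M [_ HM]] := Vbound; exists (M + 1) => x.
by apply: (HM (M + 1)) => //; rewrite ltrDl.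
Qed.

Lemma sqint_potential f : f \in Lfun mu 2%:E ->
  (fun x => V x * f x) \in Lfun mu 2%:E.
Proof.
by move=> Lf; have [M HM] := V_le; exact: (sqint_mul_bounded Lf mV HM).
Qed.

Lemma ip_potential_ge0 f : 0 <= ip mu (fun x => V x * f x) f.
Proof.
by apply: Rintegral_ge0 => x _; rewrite -mulrA mulr_ge0 ?(ltW (Vpos _))// -expr2 sqr_ge0.
Qed.

(** Cauchy-Schwarz for [f / sqrt V] and [sqrt V g]: the first is in L2 by the finite weighted norm,
    the second because [V] is bounded. *)
Lemma weighted_cauchy_schwarz f g : f \in Lfun mu 2%:E -> g \in Lfun mu 2%:E ->
  (weighted_norm2 V f < +oo)%E ->
  ip mu f g ^+ 2 <= fine (weighted_norm2 V f) * ip mu (fun x => V x * g x) g.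
Proof.
move=> Lf Lg Koo; have [M HM] := V_le.
have csV : continuous (fun x => Num.sqrt (V x)).
  by move=> x; apply: continuous_comp; [exact: Vcont|exact: sqrt_continuous].
have msV := continuous_measurable_rV csV.
have sV0 x : Num.sqrt (V x) != 0 by rewrite gt_eqF// sqrtr_gt0.
have sVK x : Num.sqrt (V x) * Num.sqrt (V x) = V x.
  by rewrite -expr2 sqr_sqrtr// ltW.
pose a x := (Num.sqrt (V x))^-1 * f x; pose b x := Num.sqrt (V x) * g x.
have Lb : b \in Lfun mu 2%:E.
  apply: (@sqint_mul_bounded _ _ _ _ g _ (Num.sqrt M)) => // x.
  by rewrite ger0_norm ?sqrtr_ge0// ler_wsqrtr// (le_trans (ler_norm _)).
have aE x : a x ^+ 2 = `|f x| ^+ 2 / V x.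
  by rewrite exprMn exprVn expr2 sVK real_normK ?num_real// mulrC.
have La : a \in Lfun mu 2%:E.
  apply: sqintP.
    apply: measurable_funM; last exact: (sqint_measurable Lf).
    apply: continuous_measurable_rV => x.
    exact: (cvgV (sV0 x) (csV x)).
  by under eq_integral do rewrite aE.
have -> : fine (weighted_norm2 V f) = nrm mu a ^+ 2.
  rewrite nrm_sqr// /ip /Rintegral; congr fine; apply: eq_integral => x _.
  by rewrite -expr2 aE.
have -> : ip mu (fun x => V x * g x) g = nrm mu b ^+ 2.
  rewrite nrm_sqr//; apply: eq_Rintegral => x _.
  by rewrite /b -{1}(sVK x); ring.
have -> : ip mu f g = ip mu a b.
  by apply: eq_Rintegral => x _; rewrite /a /b; field.
rewrite -exprMn -[leLHS]real_normK ?num_real// ler_pXn2r//;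
  rewrite ?nnegrE ?mulr_ge0 ?nrm_ge0//; exact: cauchy_schwarz.
Qed.

Section solution.
Variables (u0 : 'rV[R]_n -> R) (u : R -> 'rV[R]_n -> R).
Hypothesis Lu0 : u0 \in Lfun mu 2%:E.
Hypothesis uP : heat_solution V u0 u.

Let E t := ip mu (u t) (u t).

Lemma solution_sqint (t : R) : 0 <= t -> u t \in Lfun mu 2%:E.
Proof.
by move=> t0; have [[Hu _] _ _ _] := uP; apply: Hu; rewrite /= in_itv/= t0.
Qed.

Lemma solution_H2 (t : R) : 0 < t -> H2 (u t).
Proof.
by move=> t0; have [_ [Hu _] _ _] := uP; apply: Hu; rewrite /= in_itv/= t0.
Qed.

Lemma solution_initial w : w \in Lfun mu 2%:E -> ip mu (u 0) w = ip mu u0 w.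
Proof.
move=> Lw; have [_ _ H _] := uP; apply: eq_ae_ip => //.
  exact: solution_sqint.
by apply: filterS H => x; apply.
Qed.

Lemma solution_nrm0 : nrm mu (u 0) = nrm mu u0.
Proof.
have [_ _ H _] := uP; apply: eq_ae_nrm => //; first exact: solution_sqint.
by apply: filterS H => x; apply.
Qed.

Lemma solution_continuous (t : R) : 0 <= t ->
  nrm mu (fun x => u r x - u t x) @[r --> within `[0, +oo[ (nbhs t)] --> (0 : R).
Proof.
by move=> t0; have [[_ Hu] _ _ _] := uP; apply: Hu; rewrite /= in_itv/= t0.
Qed.

(** The equation holds almost everywhere only, so it is recorded in the form in which inner products
    see it. *)
Lemma solution_derivative : exists ut : R -> 'rV[R]_n -> R, forall t : R, 0 < t ->
  [/\ ut t \in Lfun mu 2%:E,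
      nrm mu (fun x => h^-1 * (u (t + h) x - u t x) - ut t x) @[h --> 0^']
        --> (0 : R) &
      forall w, w \in Lfun mu 2%:E -> ip mu (ut t) w =
        ip mu (weak_laplacian (u t)) w - ip mu (fun x => V x * u t x) w].
Proof.
have [_ _ _ [ut [_ [Lut _] dut] eut]] := uP; exists ut => t t0.
have It : `]0, +oo[%classic t by rewrite /= in_itv/= t0.
have Lt := Lut t It; split => [//||w Lw]; first exact: dut.
have Lu := solution_sqint (ltW t0); have LVu := sqint_potential Lu.
have Ld := sqint_weak_laplacian (solution_H2 t0).
rewrite -ipBl//; apply: eq_ae_ip => //; first exact: sqintB.
by apply: filterS (eut t t0) => x; lra.
Qed.

Lemma near_solution_sqint (t : R) : 0 < t -> \forall r \near t, u r \in Lfun mu 2%:E.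
Proof.
move=> t0; near=> r; apply: solution_sqint; apply: ltW.
by near: r; exact: lt_nbhsr.
Unshelve. all: by end_near. Qed.

Lemma near_ge0_sqint (A : set R) (t : R) : (forall r, A r -> 0 <= r) ->
  \forall r \near within A (nbhs t), u r \in Lfun mu 2%:E.
Proof.
by move=> A0; rewrite near_withinE; apply: nearW => r /A0; exact: solution_sqint.
Qed.

Lemma is_derive_energy (t : R) : 0 < t -> exists P,
  is_derive t 1 E (- (2 * P)) /\ ip mu (fun x => V x * u t x) (u t) <= P.
Proof.
move=> t0; have [ut Hut] := solution_derivative.
have [Lt dt et] := Hut t t0; have Lu := solution_sqint (ltW t0).
(* By the equation this [P] is [(H u, u)]; its gradient part is discarded in the lower bound. *)
exists (- ip mu (ut t) (u t)); split.
  have := is_derive_ip (near_solution_sqint t0) (near_solution_sqint t0) Lt Lt dt dt.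
  by rewrite (ipC _ (u t) (ut t)) mulrN opprK mulr_natl mulr2n.
have := weak_laplacian_le0 (solution_H2 t0).
rewrite et//; lra.
Qed.

(** This includes [s = 0], where continuity of [u] in L2 is all that is given; the mean value
    theorem asks for no more at an endpoint. *)
Lemma energy_continuous (s t : R) : 0 <= s -> {within `[s, t], continuous E}.
Proof.
move=> s0; apply/subspace_continuousP => r rst.
have r0 : 0 <= r by move: rst; rewrite /= in_itv/= => /andP[/(le_trans s0)].
have sub q : `[s, t]%classic q -> `[0, +oo[%classic q.
  by rewrite /= !in_itv/= andbT => /andP[/(le_trans s0)].
have c : nrm mu (fun x => u q x - u r x) @[q --> within `[s, t] (nbhs r)] --> (0 : R).
  apply: cvg_trans (solution_continuous r0); apply: cvg_app.
  by apply: (@cvg_within_map _ id) => // q.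
have nL : \forall q \near within `[s, t] (nbhs r), u q \in Lfun mu 2%:E.
  by apply: near_ge0_sqint => q /sub; rewrite /= in_itv/= andbT.
by apply: cvg_ip => //; exact: solution_sqint.
Qed.

Lemma energy_nonincreasing (s t : R) : 0 <= s -> s <= t -> E t <= E s.
Proof.
move=> s0 st.
(* [choice] needs a value at every real, hence the membership inside the statement and the dummy 0
   for [r <= 0]. *)
have H (r : R) : exists D, r \in `]s, t[ -> is_derive r 1 E D /\ D <= 0.
  have [r0|r0] := ltP 0 r; last first.
    exists 0; rewrite in_itv/= => /andP[/(le_lt_trans s0)].
    by rewrite ltNge r0.
  have [P [dP QP]] := is_derive_energy r0; exists (- (2 * P)) => _; split => //.
  by have := ip_potential_ge0 (u r); lra.
have [D HD] := choice H.
have : s == t \/ s < t by apply/orP; rewrite -le_eqVlt.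
case=> [/eqP -> //|st'].
have [|r rst] := MVT (df := D) st' _ (energy_continuous s0).
  by move=> r /HD[].
have [_ Dr] := HD r rst; move=> Er.
have : D r * (t - s) <= 0 by rewrite mulr_le0_ge0// subr_ge0.
by rewrite -Er subr_le0.
Qed.

Lemma energy_symmetric (xi : R) : 0 < xi -> E (xi / 2) = ip mu u0 (u xi).
Proof.
move=> xi0; have [ut Hut] := solution_derivative.
pose phi s := ip mu (u s) (u (xi - s)).
have dphi (s : R) : s \in `]0, xi / 2[ -> is_derive s 1 phi 0.
  rewrite in_itv/= => /andP[s0 s1].
  have r0 : 0 < xi - s by lra.
  have [Ls ds es] := Hut s s0; have [Lr dr er] := Hut _ r0.
  have nr : \forall q \near s, u (xi - q) \in Lfun mu 2%:E.
    near=> q; apply: solution_sqint; rewrite subr_ge0 ltW//.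
    by near: q; apply: lt_nbhsl; lra.
  (* Reversing time turns the increment [h] into [- h], so the reversed path has derivative
     [- ut (xi - s)]. *)
  have dr' : nrm mu (fun x => h^-1 * (u (xi - (s + h)) x - u (xi - s) x) -
      (- ut (xi - s) x)) @[h --> 0^'] --> (0 : R).
    have := cvg_dnbhs0N dr; apply: cvg_trans; apply: near_eq_cvg.
    near=> h.
    have Lh : u (xi - s - h) \in Lfun mu 2%:E.
      apply: solution_sqint; rewrite subr_ge0.
      have : `|h| < xi - s by near: h; exact: dnbhs0_lt.
      by move=> /ltW; apply: le_trans; exact: ler_norm.
    have LB := sqintB Lh (solution_sqint (ltW r0)).
    rewrite -nrmN; last by apply: sqintB => //; exact: sqintZ.
    congr nrm; apply/funext => x.
    by rewrite (_ : xi - (s + h) = xi - s - h) ?invrN; ring.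
  have := is_derive_ip (near_solution_sqint s0) nr Ls (sqintN Lr) ds dr'.
  have Hs := solution_H2 s0; have Hr := solution_H2 r0.
  have [Lus _] := Hs; have [Lur _] := Hr.
  (* With the equation inserted at both times, the Laplacian terms cancel by symmetry and the
     potential terms by commutativity. *)
  rewrite (ipC _ (u s)) ipNl// es// er// -(ipC _ (u s)) -weak_laplacian_sym//.
  rewrite (_ : _ + _ = 0)//.
  have -> : ip mu (fun x => V x * u (xi - s) x) (u s) =
      ip mu (fun x => V x * u s x) (u (xi - s)).
    by apply: eq_Rintegral => x _; ring.
  ring.
have cphi : {within `[0, xi / 2], continuous phi}.
  apply/subspace_continuousP => r; rewrite /= in_itv/= => /andP[r0 r1].
  have q0 : 0 <= xi - r by lra.
  have sub q : `[0, xi / 2]%classic q -> 0 <= q /\ 0 <= xi - q.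
    by rewrite /= in_itv/= => /andP[? ?]; split; lra.
  apply: cvg_ip; [by apply: near_ge0_sqint => q /sub[]| |exact: solution_sqint|
    exact: solution_sqint| |].
  - by rewrite near_withinE; apply: nearW => q /sub[_]; exact: solution_sqint.
  - apply: cvg_trans (solution_continuous r0); apply: cvg_app.
    by apply: (@cvg_within_map _ id) => // q /sub[q1 _]; rewrite /= in_itv/= q1.
  - apply: (@cvg_comp _ _ _ (fun q => xi - q)
      (fun q => nrm mu (fun x => u q x - u (xi - r) x)) _ _ _ _
      (solution_continuous q0)).
    apply: (@cvg_within_map _ (fun q => xi - q)) => [|q /sub[_ q1]].
      by apply: continuousB; [exact: cst_continuous|move=> A].
    by rewrite /= in_itv/= q1.
have x2 : 0 <= xi / 2 by rewrite divr_ge0// ltW.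
have [c _] := MVT_segment x2 dphi cphi; rewrite mul0r => /subr0_eq.
rewrite /phi subr0 solution_initial; last exact/solution_sqint/ltW.
by move=> <-; rewrite /E; congr ip; congr u; field.
Unshelve. all: by end_near. Qed.

Lemma energy_decay (t : R) : (weighted_norm2 V u0 < +oo)%E -> 0 <= t ->
  2 * t * E t <= fine (weighted_norm2 V u0).
Proof.
move=> Koo; rewrite le_eqVlt => /predU1P[<-|t0].
  rewrite mulr0 mul0r fine_ge0// integral_ge0// => x _.
  by rewrite lee_fin divr_ge0// ?sqr_ge0// ltW.
set K := fine _.
have H (r : R) : exists P, 0 < r -> is_derive r 1 E (- (2 * P)) /\
    ip mu (fun x => V x * u r x) (u r) <= P.
  have [r0|r0] := ltP 0 r; last by exists 0.
  by have [P ?] := is_derive_energy r0; exists P.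
have [P HP] := choice H.
have t2 : t < 2 * t by lra.
have [|xi] := MVT (df := fun r => - (2 * P r)) t2 _ (energy_continuous (ltW t0)).
  by move=> r; rewrite in_itv/= => /andP[/(lt_trans t0) /HP[]].
rewrite in_itv/= => /andP[xi1 xi2] MV.
have xi0 : 0 < xi by lra.
have [_ QP] := HP _ xi0.
set Q := ip _ _ _ in QP.
have Q0 : 0 <= Q := ip_potential_ge0 _.
have E2 : 0 <= E (2 * t) := ip_ge0 _ _.
have E0 : 0 <= E t := ip_ge0 _ _.
(* The mean value identity is [E (2 t) - E t = - 2 P t] with [P] taken at [xi]; [E (2 t) >= 0] is
   dropped and [Q <= P]. *)
have QE : 2 * Q * t <= E t by nra.
have EK : E t ^+ 2 <= K * Q.
  have Lxi := solution_sqint (ltW xi0).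
  apply: le_trans (weighted_cauchy_schwarz Lu0 Lxi Koo).
  rewrite -energy_symmetric// ler_pXn2r ?nnegrE//; last exact: ip_ge0.
  by apply: energy_nonincreasing; lra.
have K0 : 0 <= K.
  rewrite fine_ge0// integral_ge0// => x _.
  by rewrite lee_fin divr_ge0// ?sqr_ge0// ltW.
have [->|En0] := eqVneq (E t) 0; first by rewrite mulr0.
have Ep : 0 < E t by rewrite lt_neqAle eq_sym En0.
(* After multiplication by [E t] the claim follows from [2 t (E t)^2 <= 2 t K Q <= K E t]. *)
rewrite -(ler_pM2r Ep).
have : 2 * t * E t ^+ 2 <= 2 * t * (K * Q) by rewrite ler_wpM2l// mulr_ge0// ltW.
have : K * (2 * Q * t) <= K * E t by rewrite ler_wpM2l.
by rewrite expr2; lra.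
Qed.

End solution.
End heat.

Theorem theorem1p5 (R : realType) (n : nat) (V : 'rV[R]_n -> R) :
  (1 <= n)%N ->
  [bounded V x | x in [set: 'rV[R]_n]] ->
  continuous V ->
  (forall x, 0 < V x) ->
  exists2 C : R, 0 < C &
    forall (u0 : 'rV[R]_n -> R) (u : R -> 'rV[R]_n -> R),
      L2 u0 ->
      (weighted_norm2 V u0 < +oo)%E ->
      heat_solution V u0 u ->
      forall t : R, 0 <= t ->
        (((1 + t) * L2norm (u t) ^+ 2)%:E <=
         C%:E * ((L2norm u0 ^+ 2)%:E + weighted_norm2 V u0))%E.
Proof.
(* [C = 1] suffices: [E t] is at most the initial energy, and [t E t <= 2 t E t] is at most the
   weighted norm. *)
move=> _ Vbound Vcont Vpos; exists 1 => // u0 u Lu0 Koo uP t t0.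
have K0 : (0 <= weighted_norm2 V u0)%E.
  by apply: integral_ge0 => x _; rewrite lee_fin divr_ge0// ?sqr_ge0// ltW.
have Kfin : weighted_norm2 V u0 \is a fin_num by rewrite ge0_fin_numE.
rewrite mul1e -(fineK Kfin) -EFinD lee_fin.
have Lu := solution_sqint uP.
rewrite [X in _ * X](nrm_sqr (Lu t t0)) -[L2norm u0](solution_nrm0 Lu0 uP).
rewrite [X in _ <= X + _](nrm_sqr (Lu 0 (lexx 0))).
have H1 := energy_nonincreasing Vbound Vcont Vpos uP (lexx 0) t0.
have H2 := energy_decay Vbound Vcont Vpos Lu0 uP Koo t0.
have H3 := mulr_ge0 t0 (ip_ge0 (lebesgue_rV n) (u t)).
lra.
Qed.
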